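(* Let $f:\mathbb{R}^n\to\mathbb{R}$ be twice continuously differentiable and convex, let $\phi:\mathbb{R}^m\to\mathbb{R}\cup\{+\infty\}$ be a proper closed convex function, and let $E:\mathbb{R}^n\to\mathbb{R}^m$ be linear. Consider the primal problem $$(\mathcal P)\qquad \min_{x\in\mathbb{R}^n} f(x)+\phi(Ex)$$ and the dual problem $$(\mathcal D)\qquad \max_{\lambda\in\mathbb{R}^m} -f^*(-E^\top\lambda)-\phi^*(\lambda).$$ Suppose that (A1) there exists $x\in\mathbb{R}^n$ such that $x\in\mathrm{ri}(\mathrm{dom} f)$ and $Ex\in\mathrm{ri}(\mathrm{dom}\,\phi)$; (A2) there exists $\lambda\in\mathbb{R}^m$ such that $\lambda\in\mathrm{ri}(\mathrm{dom}\,\phi^* )$ and $-E^\top\lambda\in\mathrm{ri}(\mathrm{dom} f^* )$. Let $r\ge 0$, let $\{c_k\}_{k\ge0}$ be a sequence of positive numbers with $\liminf_{k\to\infty}c_k>0$, and let $\{\epsilon_k\}_{k\ge0}$ be a sequence of positive numbers with $\sum_{k=0}^\infty\epsilon_k<\infty$. Let $(x_0,\lambda_0)\in\mathbb{R}^n\times\mathbb{R}^m$ be arbitrary and let $\{(x_k,\lambda_k)\}_k$ be any sequence generated by the proximal method of multipliers, i.e. any sequence such that for every $k\ge 0$ $$\lambda_{k+1}=\lambda_k+c_k\bigl(Ex_{k+1}-\mathrm{prox}_{\phi/c_k}(Ex_{k+1}+\lambda_k/c_k)\bigr)$$ and $$\bigl\|\nabla_xL_{c_k}(x_{k+1},\lambda_k)+c_k^{-1}(x_{k+1}-x_k)\bigr\|\le\frac{\epsilon_k}{c_k}\min\bigl(1,\|(x_{k+1},\lambda_{k+1})-(x_k,\lambda_k)\|^r\bigr).$$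 Then $\{x_k\}_k$ converges to an optimal solution of $(\mathcal P)$ and $\{\lambda_k\}_k$ converges to an optimal solution of $(\mathcal D)$.
   Context: Norms and inner products are Euclidean. $f^*$, $\phi^*$ denote convex conjugates, $\mathrm{dom}$ the effective domain, $\mathrm{ri}$ the relative interior. For $c>0$, the proximal operator is $\mathrm{prox}_{\phi/c}(z)=\arg\min_{u\in\mathbb{R}^m}\bigl(\phi(u)+\tfrac c2\|u-z\|^2\bigr)$ and the Moreau envelope is $\phi_c(z)=\min_{u\in\mathbb{R}^m}\bigl(\phi(u)+\tfrac c2\|u-z\|^2\bigr)$. The augmented Lagrangian is $L_c(x,\lambda)=f(x)+\phi_c(Ex+\lambda/c)-\frac1{2c}\|\lambda\|^2$; it is differentiable in $x$ with $\nabla_xL_c(x,\lambda)=\nabla f(x)+cE^\top\bigl(Ex+\lambda/c-\mathrm{prox}_{\phi/c}(Ex+\lambda/c)\bigr)$. In the method, $x_{k+1}$ is an approximate minimizer of $x\mapsto L_{c_k}(x,\lambda_k)+\frac1{2c_k}\|x-x_k\|^2$, with the accuracy stated in the claim. *)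

(* Defs.v *)
From HB Require Import structures.
From mathcomp Require Import all_boot all_order all_algebra.
From mathcomp Require Import all_classical all_reals all_analysis.
Set Implicit Arguments.
Unset Strict Implicit.
Unset Printing Implicit Defensive.
Import Order.TTheory GRing.Theory Num.Theory.
Import numFieldNormedType.Exports.
Local Open Scope classical_set_scope.
Local Open Scope ring_scope.

(* R^n is 'cV[R]_n.  The library norm `|x| of a matrix is the sup norm, so the
   Euclidean norm is defined here; limits, differentials and neighbourhoods are
   those of the library, which do not depend on the choice of norm. *)
Definition dot {R : realType} {n : nat} (x y : 'cV[R]_n) : R :=
  \sum_(i < n) x i 0 * y i 0.

Definition enorm {R : realType} {n : nat} (x : 'cV[R]_n) : R :=
  Num.sqrt (dot x x).

Definition gradient {R : realType} {n : nat} (f : 'cV[R]_n -> R)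
    (x : 'cV[R]_n) : 'cV[R]_n :=
  \col_(i < n) 'd f x (delta_mx i 0).

Definition hessian {R : realType} {n : nat} (f : 'cV[R]_n -> R)
    (x : 'cV[R]_n) : 'M[R]_n :=
  \matrix_(i < n, j < n) ('d (gradient f) x (delta_mx j 0) : 'cV[R]_n) i 0.

Definition twice_continuously_differentiable {R : realType} {n : nat}
    (f : 'cV[R]_n -> R) : Prop :=
  [/\ forall x, differentiable f x,
      forall x, differentiable (gradient f) x
    & continuous (hessian f)].

Definition effdom {R : realType} {n : nat} (phi : 'cV[R]_n -> \bar R) :
    set 'cV[R]_n :=
  [set x | (phi x < +oo)%E].

Definition proper_efun {R : realType} {n : nat} (phi : 'cV[R]_n -> \bar R) :
    Prop :=
  (forall x, -oo < phi x)%E /\ effdom phi !=set0.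

(* Meant for functions that never take the value -oo; recall 0 * +oo = 0. *)
Definition convex_efun {R : realType} {n : nat} (phi : 'cV[R]_n -> \bar R) :
    Prop :=
  forall (x y : 'cV[R]_n) (t : R), 0 <= t <= 1 ->
    (phi (t *: x + (1 - t) *: y)%R <= t%:E * phi x + (1 - t)%R%:E * phi y)%E.

Definition conjugate {R : realType} {n : nat} (phi : 'cV[R]_n -> \bar R)
    (y : 'cV[R]_n) : \bar R :=
  ereal_sup [set ((dot y x)%:E - phi x)%E | x in [set: 'cV[R]_n]].

Definition affine_set {R : realType} {n : nat} (A : set 'cV[R]_n) : Prop :=
  forall (x y : 'cV[R]_n) (t : R), A x -> A y -> A ((1 - t) *: x + t *: y).

Definition affine_hull {R : realType} {n : nat} (A : set 'cV[R]_n) :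
    set 'cV[R]_n :=
  smallest affine_set A.

Definition relative_interior {R : realType} {n : nat} (A : set 'cV[R]_n) :
    set 'cV[R]_n :=
  [set x | A x /\ \forall y \near x, affine_hull A y -> A y].

Definition minimizers {R : realType} {n : nat} (F : 'cV[R]_n -> \bar R) :
    set 'cV[R]_n :=
  [set u | forall v, (F u <= F v)%E].

Definition maximizers {R : realType} {n : nat} (F : 'cV[R]_n -> \bar R) :
    set 'cV[R]_n :=
  [set u | forall v, (F v <= F u)%E].

Definition prox_objective {R : realType} {m : nat} (phi : 'cV[R]_m -> \bar R)
    (c : R) (z u : 'cV[R]_m) : \bar R :=
  (phi u + (c / 2 * enorm (u - z) ^+ 2)%R%:E)%E.

(* prox_{phi/c}(z).  For phi proper, closed and convex and c > 0 the minimizer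
   exists and is unique, so that the choice made by xget is immaterial. *)
Definition prox {R : realType} {m : nat} (phi : 'cV[R]_m -> \bar R)
    (c : R) (z : 'cV[R]_m) : 'cV[R]_m :=
  xget 0 (minimizers (prox_objective phi c z)).

(* phi_c(z).  The infimum is finite for phi proper, closed and convex and
   c > 0. *)
Definition moreau {R : realType} {m : nat} (phi : 'cV[R]_m -> \bar R)
    (c : R) (z : 'cV[R]_m) : R :=
  fine (ereal_inf [set prox_objective phi c z u | u in [set: 'cV[R]_m]]).

Definition aug_lagrangian {R : realType} {m n : nat} (f : 'cV[R]_n -> R)
    (phi : 'cV[R]_m -> \bar R) (E : 'M[R]_(m, n)) (c : R)
    (x : 'cV[R]_n) (lam : 'cV[R]_m) : R :=
  f x + moreau phi c (E *m x + c^-1 *: lam) - (2 * c)^-1 * enorm lam ^+ 2.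

Definition primal_objective {R : realType} {m n : nat} (f : 'cV[R]_n -> R)
    (phi : 'cV[R]_m -> \bar R) (E : 'M[R]_(m, n)) (x : 'cV[R]_n) : \bar R :=
  ((f x)%:E + phi (E *m x)%R)%E.

Definition dual_objective {R : realType} {m n : nat} (f : 'cV[R]_n -> R)
    (phi : 'cV[R]_m -> \bar R) (E : 'M[R]_(m, n)) (lam : 'cV[R]_m) : \bar R :=
  (- conjugate (EFin \o f) (- (E^T *m lam))%R - conjugate phi lam)%E.

(* Main.v *)
(** Let [T (x, lam) = (grad f x + E^T lam, (d phi)^-1 lam - E x)], a monotone
    operator with closed graph.  The two update rules say exactly that
    [w_(k+1) = (x_(k+1), lam_(k+1))] is the proximal point
    [(1 + c_k T)^-1 (w_k + e_k)] with [|e_k| <= eps_k].  For any zero [z] of [T],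
    monotonicity gives [|w_(k+1) - w_k - e_k|^2 + |w_(k+1) - z|^2 <=
    (|w_k - z| + eps_k)^2], so [|w_k - z|] converges and the residual tends to 0;
    every cluster point is then a zero of [T], hence it is the limit, and zeros of
    [T] are pairs of primal and dual solutions.

    A zero exists because of (A1) and (A2): solve [T w = - eps w], which amounts
    to minimising a coercive function, and let [eps] tend to 0.  Adding the
    subgradient inequalities at points of the four relative interiors bounds the
    components of [x], [E x], [lam] and [E^T lam] along the affine hulls of the
    four domains; the other components can be replaced by bounded ones without
    changing the inclusions. *)
Require Import Defs.
From HB Require Import structures.
From mathcomp Require Import all_boot all_order all_algebra.
From mathcomp Require Import all_classical all_reals all_analysis.
From mathcomp Require Import ring lra.
Set Implicit Arguments.
Unset Strict Implicit.
Unset Printing Implicit Defensive.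
Import Order.TTheory GRing.Theory Num.Theory.
Import numFieldNormedType.Exports.
Local Open Scope classical_set_scope.
Local Open Scope ring_scope.

(** * Euclidean inner product, coordinatewise convergence, limits along ultrafilters *)

Section EuclideanSpace.
Context {R : realType}.

Lemma dotE n (x y : 'cV[R]_n) : dot x y = (x^T *m y) 0 0.
Proof. by rewrite mxE; apply: eq_bigr => i _; rewrite mxE. Qed.

Lemma dotC n (x y : 'cV[R]_n) : dot x y = dot y x.
Proof. by apply: eq_bigr => i _; rewrite mulrC. Qed.

Lemma dotDl n (x y z : 'cV[R]_n) : dot (x + y) z = dot x z + dot y z.
Proof. by rewrite !dotE linearD mulmxDl mxE. Qed.

Lemma dotDr n (x y z : 'cV[R]_n) : dot z (x + y) = dot z x + dot z y.
Proof. by rewrite !dotE mulmxDr mxE. Qed.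

Lemma dotNl n (x z : 'cV[R]_n) : dot (- x) z = - dot x z.
Proof. by rewrite !dotE linearN mulNmx mxE. Qed.

Lemma dotNr n (x z : 'cV[R]_n) : dot z (- x) = - dot z x.
Proof. by rewrite !dotE mulmxN mxE. Qed.

Lemma dotZl n a (x z : 'cV[R]_n) : dot (a *: x) z = a * dot x z.
Proof. by rewrite !dotE linearZ -scalemxAl mxE. Qed.

Lemma dotZr n a (x z : 'cV[R]_n) : dot z (a *: x) = a * dot z x.
Proof. by rewrite !dotE -scalemxAr mxE. Qed.

Lemma dot0l n (z : 'cV[R]_n) : dot 0 z = 0.
Proof. by rewrite dotE linear0 mul0mx mxE. Qed.

Lemma dot0r n (z : 'cV[R]_n) : dot z 0 = 0.
Proof. by rewrite dotC dot0l. Qed.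

Definition dotlin := (dotDl, dotDr, dotNl, dotNr, dotZl, dotZr, dot0l, dot0r).

Lemma dot_mulmxl m n (A : 'M[R]_(m, n)) x y : dot (A *m x) y = dot x (A^T *m y).
Proof. by rewrite !dotE trmx_mul mulmxA. Qed.

Lemma mulmx_coord m n (A : 'M[R]_(m, n)) (z : 'cV[R]_n) i :
  (A *m z) i 0 = dot (row i A)^T z.
Proof. by rewrite dotE trmxK -row_mul [RHS]mxE. Qed.

Lemma dot_col_mx m n (a c : 'cV[R]_m) (b d : 'cV[R]_n) :
  dot (col_mx a b) (col_mx c d) = dot a c + dot b d.
Proof. by rewrite !dotE tr_col_mx mul_row_col mxE. Qed.

Lemma dot_ge0 n (x : 'cV[R]_n) : 0 <= dot x x.
Proof. by apply: sumr_ge0 => i _; rewrite -expr2 sqr_ge0. Qed.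

Lemma enorm_sqr n (x : 'cV[R]_n) : enorm x ^+ 2 = dot x x.
Proof. by rewrite sqr_sqrtr ?dot_ge0. Qed.

Lemma enorm_ge0 n (x : 'cV[R]_n) : 0 <= enorm x.
Proof. exact: sqrtr_ge0. Qed.

Lemma sqr_coord_le_dot n (x : 'cV[R]_n) i : x i 0 ^+ 2 <= dot x x.
Proof.
rewrite /dot (bigD1 i) //= -expr2 lerDl.
by apply: sumr_ge0 => j _; rewrite -expr2 sqr_ge0.
Qed.

Lemma dot_eq0 n (x : 'cV[R]_n) : dot x x <= 0 -> x = 0.
Proof.
move=> x0; apply/colP => i; rewrite mxE; apply/eqP; rewrite -sqrf_eq0 eq_le.
by rewrite sqr_ge0 andbT (le_trans _ x0)// sqr_coord_le_dot.
Qed.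

Lemma norm_dot_le n (x y : 'cV[R]_n) : `|dot x y| <= (dot x x + dot y y) / 2.
Proof.
have := dot_ge0 (x - y); have := dot_ge0 (x + y).
by rewrite !dotlin (dotC y x) ler_norml => h1 h2; apply/andP; split; lra.
Qed.

Lemma sqr_dot_le n (x y : 'cV[R]_n) : dot x y ^+ 2 <= dot x x * dot y y.
Proof.
have [y0|y0] := leP (dot y y) 0.
  by rewrite (dot_eq0 y0) !dot0r mulr0 expr0n.
(* This vector is |y|^2 times the part of [x] orthogonal to [y]; its squared norm is |y|^2 times the
   Gram determinant of [x] and [y]. *)
have := dot_ge0 (dot y y *: x - dot x y *: y).
rewrite !dotlin (dotC y x) => h.
have : 0 <= dot y y * (dot x x * dot y y - dot x y ^+ 2) by nra.
by rewrite pmulr_rge0 // subr_ge0.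
Qed.

Lemma dot_le_enorm n (x y : 'cV[R]_n) : dot x y <= enorm x * enorm y.
Proof.
rewrite /enorm -sqrtrM ?dot_ge0 //.
have [xy|xy] := leP (dot x y) 0; first by rewrite (le_trans xy) ?sqrtr_ge0.
by rewrite -(ger0_norm (ltW xy)) -sqrtr_sqr; apply: ler_wsqrtr; exact: sqr_dot_le.
Qed.

Lemma ler_enormD n (x y : 'cV[R]_n) : enorm (x + y) <= enorm x + enorm y.
Proof.
have := enorm_ge0 x; have := enorm_ge0 y => hy hx.
rewrite -[leRHS]ger0_norm ?addr_ge0 // -sqrtr_sqr; apply: ler_wsqrtr.
rewrite !dotlin (dotC y x) -!enorm_sqr; have := dot_le_enorm x y; nra.
Qed.

Lemma enormZ n a (x : 'cV[R]_n) : enorm (a *: x) = `|a| * enorm x.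
Proof.
by rewrite /enorm !dotlin mulrA -expr2 sqrtrM ?sqr_ge0 // sqrtr_sqr.
Qed.

(** Passes from the Euclidean norm to the sup norm, in which remainders of differentials are
    measured. *)
Lemma dot_le_mx_norm n (x : 'cV[R]_n) : dot x x <= n%:R * `|x| ^+ 2.
Proof.
rewrite /dot (le_trans (ler_sum _ (G := fun=> `|x| ^+ 2) _)) //; last first.
  by rewrite sumr_const card_ord mulr_natl.
move=> i _; rewrite -expr2 -(ger0_norm (sqr_ge0 (x i 0))) normrX.
rewrite lerXn2r ?nnegrE //.
rewrite [leRHS]mx_normrE; exact: (le_bigmax _ (fun ij => `|x ij.1 ij.2|) (i, 0)).
Qed.

(** Neighbourhoods of a column contain boxes of entrywise neighbourhoods, and a filter is closed
    under the finite intersection over the coordinates. *)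
Lemma cvg_colP n T (F : set_system T) {FF : Filter F}
    (u : T -> 'cV[R]_n) (l : 'cV[R]_n) :
  u @ F --> l <-> forall i, u t i 0 @[t --> F] --> l i 0.
Proof.
split=> [ul i|ul A [P lP PA]].
  have := @coord_continuous R n 1 i 0 l.
  exact: (cvg_comp u (fun M : 'cV[R]_n => M i 0) ul).
have : \forall t \near F, forall i, P i 0 (u t i 0).
  by apply: filter_forall => i; exact: ul.
apply: filterS => t Pt; apply: PA => i j; rewrite ord1; exact: Pt.
Qed.

Lemma cvg_dot n T (F : set_system T) {FF : Filter F} (u v : T -> 'cV[R]_n)
    (a b : 'cV[R]_n) :
  u @ F --> a -> v @ F --> b -> dot (u t) (v t) @[t --> F] --> dot a b.
Proof.
move=> /cvg_colP ua /cvg_colP vb; rewrite /dot.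
apply: (cvg_big (op := +%R)); last by move=> i _; apply: cvgM.
by move=> ?; exact: add_continuous.
Qed.

Lemma cvg_mulmx m n T (F : set_system T) {FF : Filter F} (A : 'M[R]_(m, n))
    (u : T -> 'cV[R]_n) (a : 'cV[R]_n) :
  u @ F --> a -> (A *m u t) @[t --> F] --> A *m a.
Proof.
move=> ua; apply/cvg_colP => i.
rewrite mulmx_coord; under eq_fun do rewrite mulmx_coord.
by apply: cvg_dot => //; exact: cvg_cst.
Qed.

Lemma continuous_mulmx m n (A : 'M[R]_(m, n)) :
  continuous (fun u : 'cV[R]_n => A *m u).
Proof.
move=> u; have uu : id x @[x --> nbhs (u : 'cV[R]_n)] --> (u : 'cV[R]_n).
  exact: cvg_id.
exact: cvg_mulmx uu.
Qed.

Lemma cvg_col_mx m n T (F : set_system T) {FF : Filter F}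
    (u : T -> 'cV[R]_m) (v : T -> 'cV[R]_n) (a : 'cV[R]_m) (b : 'cV[R]_n) :
  u @ F --> a -> v @ F --> b -> col_mx (u t) (v t) @[t --> F] --> col_mx a b.
Proof.
move=> /cvg_colP ua /cvg_colP vb; apply/cvg_colP => i.
case: (split_ordP i) => j ->.
  rewrite col_mxEu; under eq_fun do rewrite col_mxEu. exact: ua.
by rewrite col_mxEd; under eq_fun do rewrite col_mxEd; exact: vb.
Qed.

Lemma cvg_usubmx m n T (F : set_system T) {FF : Filter F}
    (u : T -> 'cV[R]_(m + n)) (a : 'cV[R]_(m + n)) :
  u @ F --> a -> usubmx (u t) @[t --> F] --> usubmx a.
Proof.
move=> /cvg_colP ua; apply/cvg_colP => i; rewrite mxE.
by under eq_fun do rewrite mxE; exact: ua.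
Qed.

Lemma cvg_dsubmx m n T (F : set_system T) {FF : Filter F}
    (u : T -> 'cV[R]_(m + n)) (a : 'cV[R]_(m + n)) :
  u @ F --> a -> dsubmx (u t) @[t --> F] --> dsubmx a.
Proof.
move=> /cvg_colP ua; apply/cvg_colP => i; rewrite mxE.
by under eq_fun do rewrite mxE; exact: ua.
Qed.

Lemma cvg_col0 n T (F : set_system T) {FF : Filter F} (u : T -> 'cV[R]_n) :
  dot (u t) (u t) @[t --> F] --> 0 -> u @ F --> (0 : 'cV[R]_n).
Proof.
move=> u0; apply/cvg_colP => i; rewrite mxE.
apply/cvgr0Pnorm_le => e e0.
have e20 : 0 < e ^+ 2 by rewrite exprn_gt0.
near=> t.
rewrite -[leRHS](ger0_norm (ltW e0)) -!sqrtr_sqr; apply: ler_wsqrtr.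
apply: (le_trans (sqr_coord_le_dot _ _)).
by apply: (le_trans (ler_norm _)); near: t; exact: (cvgr0_norm_le _ u0).
Unshelve. all: by end_near. Qed.

Lemma ultra_fmap T U (f : T -> U) (F : set_system T) :
  UltraFilter F -> UltraFilter (f @ F).
Proof.
move=> FU; split; first exact: fmap_proper_filter.
move=> G GP FG; apply/seteqP; split => // A GA.
have [//|FA] := in_ultra_setVsetC (f @^-1` A) FU.
have GC : G (~` A) by apply: FG.
by have [z []] := filter_ex (filterI GA GC).
Qed.

(** Compactness of a segment. Limits along an ultrafilter replace the extraction of subsequences:
    all bounded sequences converge along it simultaneously. *)
Lemma ultra_cvg_real T (F : set_system T) {FU : UltraFilter F}
    (u : T -> R) (M : R) :
  (\forall t \near F, `|u t| <= M) -> exists l : R, u @ F --> l.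
Proof.
move=> uM; have := @segment_compact R (- M) M; rewrite compact_ultra.
move=> /(_ _ (ultra_fmap u FU)) [|l [_ ul]]; last by exists l.
by apply: filterS uM => t; rewrite /= in_itv /= ler_norml.
Qed.

Lemma ultra_cvg_col n T (F : set_system T) {FU : UltraFilter F}
    (u : T -> 'cV[R]_n) :
  (forall i, exists M : R, \forall t \near F, `|u t i 0| <= M) ->
  exists l : 'cV[R]_n, u @ F --> l.
Proof.
move=> uM; have /choice[l ul] : forall i, exists l : R, u t i 0 @[t --> F] --> l.
  by move=> i; have [M /ultra_cvg_real] := uM i; apply.
by exists (\col_i l i); apply/cvg_colP => i; rewrite mxE.
Qed.

(** Since [F] is finer than [\oo], every limit along [\oo] is also a limit along [F]. *)
Lemma ultra_nat_exists : exists F : set_system nat,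
  UltraFilter F /\ F `=>` \oo.
Proof. by have [F [FU oF]] := ultraFilterLemma (eventually_filter); exists F. Qed.

End EuclideanSpace.

(** * Lower semicontinuous functions and existence of minimizers *)

Section LowerSemicontinuity.
Context {R : realType}.

Lemma ereal_ltD_split (a : R) (X Y : \bar R) : (-oo < X)%E -> (-oo < Y)%E ->
  (a%:E < X + Y)%E ->
  exists b c : R, [/\ (b%:E < X)%E, (c%:E < Y)%E & a <= b + c].
Proof.
case: X => [x| |] //; case: Y => [y| |] // _ _ aXY.
- rewrite -EFinD lte_fin in aXY; pose d := (x + y - a) / 2.
  by exists (x - d), (y - d); rewrite !lte_fin; split; rewrite /d; lra.
- by exists (x - 1), (a - x + 1); rewrite ltry lte_fin; split => //; lra.
- by exists (a - y + 1), (y - 1); rewrite ltry lte_fin; split => //; lra.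
- by exists a, 0; rewrite !ltry; split => //; lra.
Qed.

Lemma lscD (X : topologicalType) (g h : X -> \bar R) :
  (forall x, -oo < g x)%E -> (forall x, -oo < h x)%E ->
  lower_semicontinuous g -> lower_semicontinuous h ->
  lower_semicontinuous (fun x => g x + h x)%E.
Proof.
move=> g0 h0 lg lh x a agh.
have [b [c [bg ch abc]]] := ereal_ltD_split (g0 x) (h0 x) agh.
have [V xV gV] := lg _ _ bg; have [W xW hW] := lh _ _ ch.
exists (V `&` W); first exact: filterI.
move=> y [/gV gy /hW hy].
by rewrite (@le_lt_trans _ _ (b%:E + c%:E)%E) ?lee_fin // lteD.
Qed.

Lemma lsc_comp (X Y : topologicalType) (g : Y -> \bar R) (k : X -> Y) :
  continuous k -> lower_semicontinuous g -> lower_semicontinuous (g \o k).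
Proof.
move=> ck lg x a /lg[V xV gV]; exists (k @^-1` V); first exact: ck.
by move=> y /gV.
Qed.

Lemma lsc_EFin (X : topologicalType) (q : X -> R) :
  continuous q -> lower_semicontinuous (EFin \o q).
Proof.
move=> cq x a; rewrite /= lte_fin => aq.
exists (q @^-1` [set t | a < t]); first by apply: cq; exact: (lt_nbhsr aq).
by move=> y /=; rewrite lte_fin.
Qed.

(** The direct method. Only the sublevel set of [u0] has to be bounded. *)
Lemma lsc_min_exists n (G : 'cV[R]_n -> \bar R) (u0 : 'cV[R]_n) :
  lower_semicontinuous G ->
  (forall i, exists M : R, forall u, (G u <= G u0)%E -> `|u i 0| <= M) ->
  exists p, minimizers G p.
Proof.
move=> lG bG; have [|m0] := pselect (minimizers G u0); first by exists u0.
have [u1 u10] : exists u1, (G u1 < G u0)%E.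
  apply: contrapT => H; apply: m0 => v; rewrite leNgt; apply/negP => vu.
  by apply: H; exists v.
pose i := ereal_inf (range G).
have iG u : (i <= G u)%E by apply: ereal_inf_lbound; exists u.
have i0 : (i < G u0)%E by apply: le_lt_trans (iG u1) u10.
(* The filter generated by the sublevel sets above the infimum plays the part of a minimizing
   sequence. It contains the sublevel set of [G u0], as [u0] is not a minimizer here. *)
pose F := filter_from [set a | (i < a)%E] (fun a => [set u | (G u < a)%E]).
have FF : ProperFilter F.
  apply: filter_from_proper.
    apply: filter_from_filter; first by exists (G u0).
    move=> a b ia ib; exists (Order.min a b).
      by rewrite /= lt_min; apply/andP.
    by move=> u /=; rewrite lt_min => /andP[].
  by move=> a /ereal_inf_lt[_ [u _ <-]]; exists u.
have [U [UU FU]] := ultraFilterLemma FF.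
have FG a : (i < a)%E -> U [set u | (G u < a)%E].
  by move=> ia; apply: FU; exists a.
have [p Up] : exists p : 'cV[R]_n, (fun u => u) @ U --> p.
  apply: ultra_cvg_col => j; have [M HM] := bG j; exists M.
  by apply: filterS (FG _ i0) => u /ltW /HM.
exists p => v; apply: le_trans (iG v); rewrite leNgt; apply/negP => ip.
(* Semicontinuity tests real levels only. Near [p] the function exceeds [a], while the ultrafilter
   contains the set where it is below [a]. *)
have [a [ia ap]] : exists a : R, (i < a%:E)%E /\ (a%:E < G p)%E.
  move: ip; move: (G p) (i) => [r| |] [s| |] //=; rewrite ?lte_fin.
  - by move=> sr; exists ((s + r) / 2); rewrite !lte_fin; split; lra.
  - by move=> _; exists (r - 1); rewrite !lte_fin ltNyr; split => //; lra.
  - by move=> _; exists (s + 1); rewrite !lte_fin ltry; split => //; lra.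
  - by move=> _; exists 0; rewrite ltNyr ltry.
have [V pV GV] := lG _ _ ap.
have UV : U V by exact: Up pV.
have [u [/GV au ua]] := filter_ex (filterI UV (FG _ ia)).
by have := lt_trans au ua; rewrite ltxx.
Qed.

End LowerSemicontinuity.

(** * Subgradients, conjugates, proximal points and the Moreau envelope *)

Section Subgradients.
Context {R : realType}.

(** Finiteness of [g p] rules out the value -oo, at which every slope would satisfy the
    inequality. *)
Definition subgradient n (g : 'cV[R]_n -> \bar R) (p s : 'cV[R]_n) : Prop :=
  g p \is a fin_num /\ forall u, (g p + (dot s (u - p))%:E <= g u)%E.

Lemma subgradientP n (g : 'cV[R]_n -> \bar R) p s : subgradient g p s <->
  exists2 a : R, g p = a%:E & forall u, ((a + dot s (u - p))%:E <= g u)%E.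
Proof.
split=> [[/fineK gp H]|[a gp H]].
  by exists (fine (g p)) => // u; rewrite EFinD gp.
by split=> [|u]; rewrite gp // -EFinD.
Qed.

Lemma proper_fin_num n (g : 'cV[R]_n -> \bar R) u :
  proper_efun g -> effdom g u -> exists a : R, g u = a%:E.
Proof.
move=> [/(_ u) gu _] gu'; exists (fine (g u)); rewrite fineK //.
by rewrite fin_numE -ltNye gu -ltey.
Qed.

Lemma subgradient_monotone n (g : 'cV[R]_n -> \bar R) p s p' s' :
  subgradient g p s -> subgradient g p' s' -> 0 <= dot (s - s') (p - p').
Proof.
move=> /subgradientP[a gp H] /subgradientP[a' gp' H'].
have := H p'; have := H' p; rewrite gp gp' !lee_fin !dotlin; lra.
Qed.

(** Pass to the limit in the subgradient inequality at each [u] with [g u] finite, using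
    semicontinuity at [p0]; one such [u] already makes [g p0] finite. *)
Lemma subgradient_closed n T (F : set_system T) {FF : ProperFilter F}
    (g : 'cV[R]_n -> \bar R) (p s : T -> 'cV[R]_n) (p0 s0 : 'cV[R]_n) :
  proper_efun g -> lower_semicontinuous g ->
  (\forall t \near F, subgradient g (p t) (s t)) ->
  p @ F --> p0 -> s @ F --> s0 -> subgradient g p0 s0.
Proof.
move=> gpr glsc gps pp0 ss0.
have key u r : g u = r%:E -> (g p0 <= (r - dot s0 (u - p0))%:E)%E.
  move=> gu; apply/lee_addgt0Pr => e e0; rewrite -EFinD leNgt; apply/negP.
  move=> /glsc[V Vp0 gV].
  have cd : dot (s t) (u - p t) @[t --> F] --> dot s0 (u - p0).
    by apply: cvg_dot => //; apply: cvgB => //; exact: cvg_cst.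
  have near_d : \forall t \near F, dot s0 (u - p0) - e < dot (s t) (u - p t).
    apply: (cvgr_gt _ cd); lra.
  have FV : \forall t \near F, V (p t) by exact: pp0 Vp0.
  have [t [[Vt dt] /subgradientP[a gpt H]]] :=
    filter_ex (filterI (filterI FV near_d) gps).
  have := gV _ Vt; have := H u; rewrite gu gpt lee_fin lte_fin; lra.
have [_ [u0 u0d]] := gpr; have [r0 gu0] := proper_fin_num gpr u0d.
have [a ga] : exists a : R, g p0 = a%:E.
  apply: proper_fin_num => //; exact: le_lt_trans (key _ _ gu0) (ltry _).
apply/subgradientP; exists a => // u.
have [gu|] := ltP (g u) +oo%E; last by rewrite leye_eq => /eqP ->; exact: leey.
have [r gr] := proper_fin_num gpr gu.
have := key _ _ gr; rewrite ga gr !lee_fin; lra.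
Qed.

(** Minimality at [p] and convexity of [g] on the segment from [p] to [u] give an inequality that is
    divided by [t] before [t] tends to 0. A one-sided quadratic estimate of [q] suffices for
    this. *)
Lemma subgradient_of_min n (g : 'cV[R]_n -> \bar R) (q K : 'cV[R]_n -> R) p s :
  proper_efun g -> convex_efun g ->
  (forall w t, 0 <= t <= 1 ->
     q (p + t *: w) <= q p - t * dot s w + t ^+ 2 * K w) ->
  minimizers (fun u => g u + (q u)%:E)%E p -> subgradient g p s.
Proof.
move=> gpr gcv qle pmin.
have [_ [u0 u0d]] := gpr; have [r0 gu0] := proper_fin_num gpr u0d.
have [a gp] : exists a : R, g p = a%:E.
  apply: proper_fin_num => //; rewrite /effdom /=.
  have := pmin u0; rewrite gu0 -EFinD.
  by case: (g p) => [x| |] //; rewrite ltry.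
apply/subgradientP; exists a => // u.
have [gu|] := ltP (g u) +oo%E; last by rewrite leye_eq => /eqP ->; exact: leey.
have [b gb] := proper_fin_num gpr gu; rewrite gb lee_fin.
set w := u - p.
have key t : 0 < t <= 1 -> 0 <= b - a - dot s w + t * K w.
  move=> /andP[t0 t1]; have t01 : 0 <= t <= 1 by rewrite ltW.
  have := gcv u p t t01.
  have -> : t *: u + (1 - t) *: p = p + t *: w.
    by rewrite scalerBl scale1r /w scalerBr addrCA addrA addrC addrA.
  have := pmin (p + t *: w); have := qle w t t01.
  rewrite gp gb -!EFinM -!EFinD.
  case: (g (p + t *: w)) => [c| |] //; rewrite ?lee_fin.
  move=> h1 h2 h3.
  have h : 0 <= t * (b - a - dot s w + t * K w) by nra.
  by rewrite -(pmulr_rge0 _ t0).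
have [K0|K0] := leP (K w) 0.
  have : 0 < (1 : R) <= 1 by rewrite ltr01 lexx.
  by move=> /key; lra.
rewrite leNgt; apply/negP => lt0.
pose d := a + dot s w - b; have d0 : 0 < d by rewrite /d; lra.
(* Small enough that [t * K w] is at most half of the violation [d], which contradicts [key]. *)
pose t := Num.min 1 (d / (2 * K w)).
have t0 : 0 < t by rewrite /t lt_min ltr01 divr_gt0 // mulr_gt0.
have t1 : t <= 1 by rewrite /t ge_min lexx.
have tK : t * K w <= d / 2.
  have : t <= d / (2 * K w) by rewrite /t ge_min lexx orbT.
  rewrite ler_pdivlMr ?mulr_gt0 // => ?; lra.
have := key t; rewrite t0 t1 => /(_ isT); rewrite /d in d0 tK; lra.
Qed.

Lemma quadratic_expansion n k (A : 'M[R]_(k, n)) b p w t :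
  dot (A *m (p + t *: w) - b) (A *m (p + t *: w) - b) / 2 =
  dot (A *m p - b) (A *m p - b) / 2 + t * dot (A^T *m (A *m p - b)) w
  + t ^+ 2 * (dot (A *m w) (A *m w) / 2).
Proof.
rewrite dot_mulmxl trmxK mulmxDr -scalemxAr addrAC.
move: (A *m p - b) (A *m w) => x y; rewrite !dotlin (dotC y x); lra.
Qed.

Lemma subgradient_of_quadratic_min n k (g : 'cV[R]_n -> \bar R)
    (A : 'M[R]_(k, n)) b p :
  proper_efun g -> convex_efun g ->
  minimizers (fun u => g u + (dot (A *m u - b) (A *m u - b) / 2)%:E)%E p ->
  subgradient g p (- (A^T *m (A *m p - b))).
Proof.
move=> gpr gcv; apply: (subgradient_of_min
  (K := fun w => dot (A *m w) (A *m w) / 2)) => // w t _.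
by rewrite quadratic_expansion dotNl mulrN opprK.
Qed.

(** The left inverse [K] makes the quadratic term coercive, so that it dominates the affine minorant
    of [g]. *)
Lemma quadratic_min_exists n k (g : 'cV[R]_n -> \bar R)
    (A : 'M[R]_(k, n)) (K : 'M[R]_(n, k)) b a C :
  proper_efun g -> lower_semicontinuous g ->
  (forall u, ((dot a u - C)%:E <= g u)%E) -> K *m A = 1%:M ->
  exists p,
    minimizers (fun u => g u + (dot (A *m u - b) (A *m u - b) / 2)%:E)%E p.
Proof.
move=> gpr glsc gC KA; have [gNy [u0 u0d]] := gpr.
have [r0 gu0] := proper_fin_num gpr u0d.
apply: (lsc_min_exists (u0 := u0)).
  apply: lscD => // [u|]; first exact: ltNyr.
  have cA : continuous (fun u : 'cV[R]_n => A *m u - b).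
    move=> u; have Au := @continuous_mulmx _ _ _ A u.
    exact: cvgB Au (cvg_cst b).
  by apply: lsc_EFin => u; exact: cvgM (cvg_dot (cA u) (cA u)) (cvg_cst _).
move=> i; set M0 := r0 + dot (A *m u0 - b) (A *m u0 - b) / 2.
set k0 := (row i K)^T; set a' := K^T *m a.
(* With [z = A u - b], completing the square in the sublevel inequality bounds |z + a'|^2 / 2 by the
   parenthesis; coordinate [i] of [u] is [dot k0 (z + a') + dot k0 (b - a')], whose first term is
   handled by [norm_dot_le]. *)
exists (dot k0 k0 / 2 + (M0 + C - dot a' b + dot a' a' / 2)
        + `|dot k0 (b - a')|) => u.
rewrite gu0 -EFinD -/M0 => le0.
have {le0}le0 : dot a u - C + dot (A *m u - b) (A *m u - b) / 2 <= M0.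
  move: le0 (gC u); case: (g u) => [x| |] //=.
  by rewrite -EFinD !lee_fin; lra.
pose z := A *m u - b; have uz : u = K *m (z + b).
  by rewrite /z subrK mulmxA KA mul1mx.
have az : dot a u = dot a' z + dot a' b.
  by rewrite -dotDr [in LHS]uz dotC dot_mulmxl dotC.
rewrite -/z az in le0; clearbody z.
have ui : u i 0 = dot k0 (z + a') + dot k0 (b - a').
  by rewrite -dotDr addrACA subrr addr0 addrC [in LHS]uz mulmx_coord addrC.
rewrite ui (le_trans (ler_normD _ _)) // lerD2r.
rewrite (le_trans (norm_dot_le _ _)) // !dotlin (dotC z a'); lra.
Qed.

(** The constant is the value of the conjugate at [s], which is not -oo because [g] is finite
    somewhere. *)
Lemma conjugate_minorant n (g : 'cV[R]_n -> \bar R) s :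
  proper_efun g -> effdom (conjugate g) s ->
  exists C : R, forall u, ((dot s u - C)%:E <= g u)%E.
Proof.
move=> gpr sd; have [_ [u0 u0d]] := gpr; have [r0 gu0] := proper_fin_num gpr u0d.
have ub u : ((dot s u)%:E - g u <= conjugate g s)%E.
  by apply: ereal_sup_ubound; exists u.
move: sd ub; rewrite /effdom /=; case: (conjugate g s) => [C| |] // _ ub.
  exists C => u; have := ub u; have := gpr.1 u.
  by case: (g u) => [r| |] //= _; rewrite ?leey // -EFinB !lee_fin; lra.
by have := ub u0; rewrite gu0.
Qed.

Lemma conjugate_subgradient n (g : 'cV[R]_n -> \bar R) p s :
  subgradient g p s -> conjugate g s = ((dot s p)%:E - g p)%E.
Proof.
move=> /subgradientP[a gp H]; apply/eqP; rewrite eq_le; apply/andP; split.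
  apply: ge_ereal_sup => _ [u _ <-]; rewrite gp; have := H u.
  by case: (g u) => [r| |] //=; rewrite -?EFinB ?lee_fin ?dotlin ?leNye //; lra.
by apply: ereal_sup_ubound; exists p.
Qed.

Lemma effdom_conjugate_subgradient n (g : 'cV[R]_n -> \bar R) p s :
  subgradient g p s -> effdom (conjugate g) s.
Proof.
move=> gps; rewrite /effdom /= (conjugate_subgradient gps).
by case/subgradientP : gps => a -> _; rewrite -EFinB ltry.
Qed.

(** Existence comes from [quadratic_min_exists] with [A] equal to sqrt(c) times the identity; [xget]
    then returns a minimizer. *)
Lemma minimizers_prox n (g : 'cV[R]_n -> \bar R) a C (c : R) z :
  proper_efun g -> lower_semicontinuous g ->
  (forall u, ((dot a u - C)%:E <= g u)%E) -> 0 < c ->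
  minimizers (prox_objective g c z) (prox g c z).
Proof.
move=> gpr glsc gC c0; have sc0 : 0 < Num.sqrt c by rewrite sqrtr_gt0.
have [|p pmin] := quadratic_min_exists (A := (Num.sqrt c)%:M)
  (K := (Num.sqrt c)^-1%:M) (Num.sqrt c *: z) gpr glsc gC.
  by rewrite -scalar_mxM mulVf // gt_eqF.
apply: (xgetPex 0); exists p => v.
have E u : prox_objective g c z u = (g u +
    (dot ((Num.sqrt c)%:M *m u - Num.sqrt c *: z)
      ((Num.sqrt c)%:M *m u - Num.sqrt c *: z) / 2)%:E)%E.
  rewrite /prox_objective enorm_sqr mul_scalar_mx -scalerBr dotZl dotZr.
  by rewrite mulrA -expr2 sqr_sqrtr ?ltW // mulrAC.
by rewrite !E.
Qed.

Lemma subgradient_prox n (g : 'cV[R]_n -> \bar R) a C (c : R) z :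
  proper_efun g -> lower_semicontinuous g -> convex_efun g ->
  (forall u, ((dot a u - C)%:E <= g u)%E) -> 0 < c ->
  subgradient g (prox g c z) (c *: (z - prox g c z)).
Proof.
move=> gpr glsc gcv gC c0; have := minimizers_prox z gpr glsc gC c0.
move: (prox g c z) => p.
apply: (subgradient_of_min (K := fun w => c / 2 * dot w w)) => // w t _.
rewrite !enorm_sqr -addrA (addrC (t *: w)) addrA !dotlin (dotC w p) (dotC w z).
by rewrite !(dotC z p); lra.
Qed.

(* Monotonicity applied to [(y, s)] and to the proximal point of [y + s + v]
   forces the latter to be [y + v]. *)
Lemma subgradient_shift_point n (g : 'cV[R]_n -> \bar R) y s v :
  proper_efun g -> lower_semicontinuous g -> convex_efun g ->
  subgradient g y s ->
  (forall t, effdom (conjugate g) t -> dot (t - s) v = 0) ->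
  subgradient g (y + v) s.
Proof.
move=> gpr glsc gcv gys perp.
have [C gC] := conjugate_minorant gpr (effdom_conjugate_subgradient gys).
have := subgradient_prox (y + s + v) gpr glsc gcv gC ltr01.
rewrite scale1r; set p := prox _ _ _; set s' := _ - p => gps.
have s'v := perp _ (effdom_conjugate_subgradient gps).
have mono := subgradient_monotone gys gps.
have yp : y - p = s' - s - v.
  by rewrite /s'; apply/colP => i; rewrite !mxE; ring.
clearbody s'; have ss : s' - s = 0.
  by apply: dot_eq0; move: mono s'v; rewrite yp !dotlin (dotC s' s); lra.
have s's : s' = s by apply/eqP; rewrite -subr_eq0 ss.
suff -> : y + v = p by rewrite -s's.
by rewrite -[y](subrK p) yp ss sub0r addrAC addNr add0r.
Qed.

(** On the domain the added term vanishes; outside it the right-hand side is +oo. *)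
Lemma subgradient_shift_slope n (g : 'cV[R]_n -> \bar R) y s v :
  subgradient g y s ->
  (forall u, effdom g u -> dot v (u - y) = 0) ->
  subgradient g y (s + v).
Proof.
move=> [gy H] perp; split=> // u; have [gu|] := ltP (g u) +oo%E.
  by rewrite dotDl perp // addr0.
by rewrite leye_eq => /eqP ->; exact: leey.
Qed.

Lemma moreau_minimizer n (g : 'cV[R]_n -> \bar R) (c : R) z p :
  minimizers (prox_objective g c z) p ->
  moreau g c z = fine (prox_objective g c z p).
Proof.
move=> pmin; congr fine; apply/eqP; rewrite eq_le; apply/andP; split.
  by apply: ereal_inf_lbound; exists p.
by apply: le_ereal_inf_tmp => _ [u _ <-]; exact: pmin.
Qed.

(** A first-order expansion with quadratic remainder, so the envelope has gradient c (z - prox z).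
    The upper bound uses the proximal point of [z] as a competitor at [z + h]; the lower bound uses
    the subgradient inequality at that point. *)
Lemma moreau_sandwich n (g : 'cV[R]_n -> \bar R) a C (c : R) z h :
  proper_efun g -> lower_semicontinuous g -> convex_efun g ->
  (forall u, ((dot a u - C)%:E <= g u)%E) -> 0 < c ->
  0 <= moreau g c (z + h) - moreau g c z - c * dot (z - prox g c z) h
    <= c / 2 * dot h h.
Proof.
move=> gpr glsc gcv gC c0.
have pmin := minimizers_prox z gpr glsc gC c0.
have qmin := minimizers_prox (z + h) gpr glsc gC c0.
have /subgradientP[r gp H] := subgradient_prox z gpr glsc gcv gC c0.
have /subgradientP[r' gq _] := subgradient_prox (z + h) gpr glsc gcv gC c0.
rewrite (moreau_minimizer pmin) (moreau_minimizer qmin).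
move: (prox g c z) (prox g c (z + h)) pmin qmin gp H gq => p q pmin qmin gp H gq.
have := qmin p; have := H q.
rewrite /prox_objective gp gq !enorm_sqr -!EFinD !lee_fin /=.
(* Half of this quantity is what remains in the lower bound after expansion. *)
have := mulr_ge0 (ltW c0) (dot_ge0 (q - p - h)).
rewrite !dotlin !(dotC z p, dotC h p, dotC q p, dotC h z, dotC q z, dotC q h).
by move=> h1 h2 h3; apply/andP; split; lra.
Qed.

End Subgradients.

(** * Gradients of convex functions and of the augmented Lagrangian *)

Section Gradients.
Context {R : realType}.

Lemma convex_efun_EFin n (f : 'cV[R]_n -> R) :
  convex_function [set: convex_lmodType 'cV[R]_n] f -> convex_efun (EFin \o f).
Proof.
move=> fcv x y t /andP[t0 t1] /=.
have := fcv (Itv01 t0 t1) x y (mem_set I) (mem_set I).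
by rewrite convRE -!EFinM -EFinD lee_fin.
Qed.

Lemma diff_gradient n (f : 'cV[R]_n -> R) x h :
  'd f x h = dot (gradient f x) h.
Proof.
rewrite [in LHS](matrix_sum_delta h) linear_sum; apply: eq_bigr => i _.
by rewrite big_ord1 linearZ mxE mulrC.
Qed.

(** By convexity the difference quotient from [p] towards [u] with step in (0, 1] is at most
    [f u - f p]; the step then tends to 0 from the right. *)
Lemma gradient_subgradient n (f : 'cV[R]_n -> R) p :
  convex_function [set: convex_lmodType 'cV[R]_n] f -> differentiable f p ->
  subgradient (EFin \o f) p (gradient f p).
Proof.
move=> /convex_efun_EFin fcv df; apply/subgradientP; exists (f p) => // u.
rewrite lee_fin -lerBrDl -diff_gradient -deriveE //; set w := u - p.
have dp : h^-1 *: (f (h *: w + p) - f p) @[h --> (0 : R)^'+] --> 'D_w f p.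
  apply: cvg_dnbhs_at_right; exact: (diff_derivable (v := w) df).
apply: (ler_cvg_to dp (cvg_cst (f u - f p))); near=> h.
have h0 : 0 < h by near: h; exact: nbhs_right_gt.
have h1 : h <= 1 by near: h; exact: nbhs_right_le.
have h01 : 0 <= h <= 1 by rewrite ltW.
rewrite -[_ *: _]/(h^-1 * (f (h *: w + p) - f p)) ler_pdivrMl //.
have := fcv u p h h01; rewrite /= -!EFinM -EFinD lee_fin.
have -> : h *: u + (1 - h) *: p = h *: w + p.
  by rewrite /w; apply/colP => i; rewrite !mxE; ring.
lra.
Unshelve. all: by end_near. Qed.

(** Allows [dot s] to be used as a bundled linear map, the form required of a candidate
    differential. *)
Lemma linear_dot n (s : 'cV[R]_n) : linear (dot s : 'cV[R]_n -> R^o).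
Proof. by move=> a u v; rewrite !dotlin. Qed.
HB.instance Definition _ n (s : 'cV[R]_n) :=
  GRing.isLinear.Build R 'cV[R]_n R^o *:%R (dot s) (linear_dot s).


Lemma differentiable_sandwich n (M : 'cV[R]_n -> R) (K : R) x s :
  (forall h, 0 <= M (x + h) - M x - dot s h <= K * dot h h) ->
  differentiable M x /\ 'd M x = dot s :> (_ -> _).
Proof.
move=> sand.
have cdot : continuous (dot s : 'cV[R]_n -> R).
  move=> u; have uu : id v @[v --> (u : 'cV[R]_n)] --> (u : 'cV[R]_n).
    exact: cvg_id.
  exact: cvg_dot (cvg_cst s) uu.
pose N : 'cV[R]_n -> R^o := M.
pose df : {linear 'cV[R]_n -> R^o} := dot s.
have expn : N \o shift (x : 'cV[R]_n) = cst (N x) + df +o_ (0 : 'cV[R]_n) id.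
  apply/eqaddoP => _/posnumP[e].
  (* The factor [n] comes from [dot_le_mx_norm]; the added 1 keeps [C] positive for the division. *)
  pose C := `|K| * n%:R + 1; have C0 : 0 < C by rewrite ltr_wpDl // mulr_ge0.
  near=> h.
  have -> : (N \o shift (x : 'cV[R]_n) - (cst (N x) + df)) h =
      M (x + h) - M x - dot s h.
    by rewrite -[LHS]/(M (h + x) - (M x + dot s h)) (addrC h) opprD addrA.
  have /andP[lo hi] := sand h; rewrite ger0_norm // (le_trans hi) //.
  have he : `|h| <= e%:num / C.
    near: h; have eC0 : 0 < e%:num / C by rewrite divr_gt0.
    exact: (@nbhs0_le _ 'cV[R]_n _ eC0).
  have hh := dot_le_mx_norm h.
  have KC : K * dot h h <= C * `|h| ^+ 2.
    have := ler_norm K; have := dot_ge0 h; have := normr_ge0 K => k0 d0 kK.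
    rewrite /C mulrDl -mulrA mul1r.
    rewrite (le_trans (ler_wpM2r d0 kK)) // ler_wpDr ?exprn_ge0 //.
    exact: ler_wpM2l.
  rewrite (le_trans KC) // expr2 mulrA ler_wpM2r //.
  by rewrite mulrC -ler_pdivlMr.
have dE : 'd N x = df :> (_ -> _) by exact: diff_unique.
by split=> //; apply/diff_locallyP; rewrite dE.
Unshelve. all: by end_near. Qed.

(** Cauchy-Schwarz row by row; the factor is the squared Frobenius norm of [A]. *)
Lemma dot_mulmx_bound m n (A : 'M[R]_(m, n)) x :
  dot (A *m x) (A *m x) <= (\sum_i dot (row i A)^T (row i A)^T) * dot x x.
Proof.
rewrite mulr_suml; apply: ler_sum => i _.
by rewrite -expr2 mulmx_coord sqr_dot_le.
Qed.

(** The envelope term inherits the quadratic sandwich through [E], with increment [E *m h], and is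
    therefore differentiated directly as a function of [u]. *)
Lemma gradient_aug_lagrangian m n (f : 'cV[R]_n -> R) (phi : 'cV[R]_m -> \bar R)
    (E : 'M[R]_(m, n)) a C c x lam :
  differentiable f x -> proper_efun phi -> lower_semicontinuous phi ->
  convex_efun phi -> (forall u, ((dot a u - C)%:E <= phi u)%E) -> 0 < c ->
  let z := E *m x + c^-1 *: lam in
  gradient (fun u => aug_lagrangian f phi E c u lam) x =
  gradient f x + E^T *m (c *: (z - prox phi c z)).
Proof.
move=> df ppr plsc pcv pC c0 z; set s := E^T *m _.
pose M u := moreau phi c (E *m u + c^-1 *: lam).
have [dM dME] : differentiable M x /\ 'd M x = dot s :> (_ -> _).
  apply: (differentiable_sandwich
    (K := c / 2 * \sum_i dot (row i E)^T (row i E)^T)) => h.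
  have := moreau_sandwich z (E *m h) ppr plsc pcv pC c0.
  have -> : z + E *m h = E *m (x + h) + c^-1 *: lam by rewrite mulmxDr /z addrAC.
  rewrite -dotZl dotC dot_mulmxl dotC => /andP[-> h2] /=.
  rewrite (le_trans h2) // -[leRHS]mulrA.
  apply: ler_wpM2l; last exact: dot_mulmx_bound.
  by rewrite divr_ge0 // ltW.
have -> : (fun u => aug_lagrangian f phi E c u lam) =
    (f + M) + cst (- ((2 * c)^-1 * enorm lam ^+ 2)) by [].
apply/colP => i; rewrite mxE [RHS]mxE [X in _ = X + _]mxE.
rewrite diffD //; last exact: differentiableD.
rewrite diffD // diff_cst /= addr0 dME; congr (_ + _).
by rewrite dotC dotE trmx_delta -rowE mxE.
Qed.

End Gradients.

(** * Spanning frames at points of the relative interior *)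

Section RelativeInterior.
Context {R : realType}.

Lemma affine_hull_affine n (A : set 'cV[R]_n) : affine_set (affine_hull A).
Proof. by move=> x y t Hx Hy M MA; apply: MA.1; [exact: Hx MA|exact: Hy MA]. Qed.

(** The rows of [B] are short enough to stay in [A] in both directions from [a], yet span every
    [u - a] with [u] in [A]. Estimates at finitely many points thus control all directions of the
    affine hull. *)
Lemma relative_interior_frame n (A : set 'cV[R]_n) a : relative_interior A a ->
  exists k (B : 'M[R]_(k, n)),
    (forall i, A (a + (row i B)^T) /\ A (a - (row i B)^T)) /\
    (forall u v, A u -> B *m v = 0 -> dot (u - a) v = 0).
Proof.
move=> [Aa Anear]; set H := affine_hull A in Anear.
have AH : A `<=` H by exact: sub_gen_smallest.
have Hcomb (t : R) (v : 'cV[R]_n) : H (a + v) -> H (a + t *: v).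
  have -> : a + t *: v = (1 - t) *: a + t *: (a + v).
    apply/colP => i; rewrite !mxE; ring.
  by move=> Hv; apply: affine_hull_affine => //; exact: AH.
(* Take the maximal rank of a matrix whose rows are directions of the hull at [a]: adjoining [u - a]
   as a row cannot raise it, so [u - a] lies in the row space. *)
pose P r := `[< exists k (B : 'M[R]_(k, n)),
  (forall i, H (a + (row i B)^T)) /\ \rank B = r >].
have P0 : exists r, P r.
  exists 0%N; apply/asboolP; exists 0%N, 0.
  by split; [case|exact: mxrank0].
have Pn r : P r -> (r <= n)%N.
  by move=> /asboolP[k [B [_ rB]]]; rewrite -rB; exact: rank_leq_col.
case: (ex_maxnP P0 Pn) => r /asboolP[k [B [HB rB]]] rmax.
have AB u : A u -> ((u - a)^T <= B)%MS.
  move=> Au; set w := (u - a)^T.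
  have : P (\rank (col_mx B w)).
    apply/asboolP; exists (k + 1)%N, (col_mx B w); split=> // i.
    case: (split_ordP i) => j ->; first by rewrite rowKu.
    by rewrite rowKd row_id /w trmxK addrC subrK; exact: AH.
  move=> /rmax; rewrite -rB => rle.
  have BBw : (B <= col_mx B w)%MS.
    by have := submx_refl (col_mx B w); rewrite col_mx_sub => /andP[].
  have := mxrank_leqif_sup BBw => -[le1 eq1].
  have : (col_mx B w <= B)%MS by rewrite -eq1 eqn_leq le1 rle.
  by rewrite col_mx_sub => /andP[].
have nearA t0 i :
    \forall t \near (0 : R)^'+, A (a + (t0 * t) *: (row i B)^T).
  have ct : a + (t0 * t) *: (row i B)^T @[t --> (0 : R)^'+] --> a.
    rewrite -[X in _ --> X](addr0 a) -[X in _ + X](scale0r (row i B)^T).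
    apply: cvgD; first exact: cvg_cst.
    apply: cvgZr_tmp; rewrite -[X in _ --> X](mulr0 t0).
    by apply: cvgM; [exact: cvg_cst|exact: (@cvg_at_right_filter R R id)].
  have : \forall t \near (0 : R)^'+, H (a + (t0 * t) *: (row i B)^T) ->
      A (a + (t0 * t) *: (row i B)^T) by exact: ct _ Anear.
  by apply: filterS => t; apply; exact: Hcomb (HB i).
(* There are finitely many rows and two signs, so one positive scale [t] serves them all. *)
have : \forall t \near (0 : R)^'+, 0 < t /\
    (forall i, A (a + (1 * t) *: (row i B)^T)) /\
    (forall i, A (a + (-1 * t) *: (row i B)^T)).
  near=> t; split; first by near: t; exact: nbhs_right_gt.
  by split; near: t; apply: filter_forall => i; exact: nearA.
move=> /filter_ex[t [t0 [At ANt]]].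
exists k, (t *: B); split=> [i|u v Au].
  rewrite -[row i _]/(row i (t *: B)) linearZ linearZ /=.
  by have := At i; have := ANt i; rewrite mul1r mulN1r scaleNr.
rewrite -scalemxAl => /eqP; rewrite scaler_eq0 gt_eqF //= => /eqP Bv.
by rewrite dotE; have /submxP[D ->] := AB u Au; rewrite -mulmxA Bv mulmx0 mxE.
Unshelve. all: by end_near. Qed.

End RelativeInterior.

(** * Convergence of the inexact proximal point iteration *)

Section InexactProximalPoint.
Context {R : realType}.

(** [T w v] reads: v belongs to T(w). Closedness is stated for proper filters so that a cluster
    point can be taken along an ultrafilter. *)
Lemma inexact_proximal_point n (T : 'cV[R]_n -> 'cV[R]_n -> Prop)
    (c eps : nat -> R) (w e : nat -> 'cV[R]_n) (z : 'cV[R]_n) (d S : R) :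
  (forall w v w' v', T w v -> T w' v' -> 0 <= dot (v - v') (w - w')) ->
  (forall (F : set_system nat) (w v : nat -> 'cV[R]_n) (w0 v0 : 'cV[R]_n),
     ProperFilter F -> (forall k, T (w k) (v k)) ->
     w @ F --> w0 -> v @ F --> v0 -> T w0 v0) ->
  T z 0 ->
  (forall k, 0 < c k) -> 0 < d -> (\forall k \near \oo, d <= c k) ->
  (forall k, 0 <= eps k) -> (forall k, \sum_(0 <= j < k) eps j <= S) ->
  (forall k, enorm (e k) <= eps k) ->
  (forall k, T (w k.+1) ((c k)^-1 *: (w k + e k - w k.+1))) ->
  exists2 ws : 'cV[R]_n, w @ \oo --> ws & T ws 0.
Proof.
move=> Tmono Tclosed Tz c0 d0 dc eps0 epsS eeps Tw.
have shift (u : nat -> R) (l : R) : u @ \oo --> l -> u k.+1 @[k --> \oo] --> l.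
  by rewrite -(cvg_shiftS u).
pose q k := w k + e k - w k.+1.
pose D z k := enorm (w k - z).
pose sig k := \sum_(0 <= j < k) eps j.
have sigS k : sig k.+1 = sig k + eps k by rewrite /sig big_nat_recr.
have sig_cvg : cvgn sig.
  apply: nondecreasing_is_cvgn; last by exists S => _ [k _ <-]; exact: epsS.
  by apply/nondecreasing_seqP => k; rewrite sigS lerDl.
have eps_cvg : eps @ \oo --> (0 : R).
  have E : eps = (fun k => sig k.+1 - sig k).
    by apply/funext => k; rewrite sigS addrC addKr.
  have sig1 : sig k.+1 @[k --> \oo] --> limn sig by apply: shift.
  by rewrite E -(subrr (limn sig)); apply: cvgB.
(* Monotonicity makes the product of [q k] with [w k.+1 - z'] nonnegative, and these two vectors add
   up to [w k + e k - z']. *)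
have fejer z' k : T z' 0 ->
    dot (q k) (q k) + D z' k.+1 ^+ 2 <= (D z' k + eps k) ^+ 2.
  move=> Tz'; have := Tmono _ _ _ _ (Tw k) Tz'.
  rewrite subr0 dotZl pmulr_rge0 ?invr_gt0 // -/(q k) => qw.
  have tri : enorm (w k + e k - z') <= D z' k + eps k.
    rewrite addrAC (le_trans (ler_enormD _ _)) // lerD2l; exact: eeps.
  have : dot (w k + e k - z') (w k + e k - z') <= (D z' k + eps k) ^+ 2.
    by rewrite -enorm_sqr lerXn2r ?nnegrE ?enorm_ge0 ?addr_ge0 ?enorm_ge0.
  have -> : w k + e k - z' = q k + (w k.+1 - z') by rewrite addrA subrK.
  rewrite [D z' k.+1]/D enorm_sqr; move: (w k.+1 - z') (q k) qw => b a qw.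
  rewrite !dotlin (dotC b a); set r := (_ ^+ 2); lra.
have fejer1 z' k : T z' 0 -> D z' k.+1 <= D z' k + eps k.
  move=> Tz'; have h0 : 0 <= D z' k + eps k by rewrite addr_ge0 ?enorm_ge0.
  have h1 : 0 <= D z' k.+1 by exact: enorm_ge0.
  rewrite -ler_sqr ?nnegrE //.
  by apply: le_trans (fejer _ k Tz'); rewrite lerDr dot_ge0.
have D_cvg z' : T z' 0 -> cvgn (D z').
  move=> Tz'.
  (* The distance itself may increase by [eps k]; subtracting the partial sums makes it
     nonincreasing, and it stays above [- S]. *)
  have u_cvg : cvgn (fun k => D z' k - sig k).
    apply: nonincreasing_is_cvgn.
      by apply/nonincreasing_seqP => k; rewrite sigS; have := fejer1 _ k Tz'; lra.
    exists (- S) => _ [k _ <-].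
    have := epsS k; have := enorm_ge0 (w k - z'); rewrite -/(sig k) /D; lra.
  rewrite (_ : D z' = fun k => (D z' k - sig k) + sig k); first exact: is_cvgD.
  by apply/funext => k; rewrite subrK.
have q_cvg : dot (q k) (q k) @[k --> \oo] --> (0 : R).
  have Dl : D z @ \oo --> limn (D z) by exact: D_cvg.
  have Dl1 : D z k.+1 @[k --> \oo] --> limn (D z) by apply: shift.
  have bnd : (D z k + eps k) ^+ 2 - D z k.+1 ^+ 2 @[k --> \oo] --> (0 : R).
    have -> : (0 : R) =
        (limn (D z) + 0) * (limn (D z) + 0) - limn (D z) * limn (D z).
      by rewrite addr0 subrr.
    under eq_fun do rewrite !expr2.
    by apply: cvgB; apply: cvgM => //; apply: cvgD.
  apply: (squeeze_cvgr _ (cvg_cst 0) bnd); near=> k.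
  by rewrite dot_ge0 lerBrDr fejer.
have v_cvg : (c k)^-1 *: q k @[k --> \oo] --> (0 : 'cV[R]_n).
  apply: cvg_col0.
  have bnd : (d^-1 ^+ 2) * dot (q k) (q k) @[k --> \oo] --> (0 : R).
    by rewrite -(mulr0 (d^-1 ^+ 2)); apply: cvgM => //; exact: cvg_cst.
  apply: (squeeze_cvgr _ (cvg_cst 0) bnd); near=> k.
  have dck : d <= c k by near: k.
  have ck : (c k)^-1 <= d^-1 by rewrite lef_pV2 ?posrE.
  have ck0 : 0 <= (c k)^-1 by rewrite invr_ge0 ltW.
  rewrite dot_ge0 dotZl dotZr mulrA -expr2 ler_wpM2r ?dot_ge0 //.
  by rewrite lerXn2r ?nnegrE // (le_trans ck0).
have [F [FU Foo]] := ultra_nat_exists.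
have D_bnd k : D z k <= D z 0%N + S.
  have : D z k <= D z 0%N + sig k.
    elim: k => [|k IH]; first by rewrite /sig big_nil addr0.
    by rewrite sigS; have := fejer1 _ k Tz; lra.
  have := epsS k; rewrite -/(sig k); lra.
(* The index is shifted because the inclusion [Tw k] is located at [w k.+1]. *)
have [ws Fws] : exists ws : 'cV[R]_n, w k.+1 @[k --> F] --> ws.
  apply: ultra_cvg_col => i; exists (1 + (D z 0%N + S) ^+ 2 + `|z i 0|).
  near=> k.
  have -> : w k.+1 i 0 = (w k.+1 - z) i 0 + z i 0 by rewrite !mxE subrK.
  rewrite (le_trans (ler_normD _ _)) // lerD2r.
  have : (w k.+1 - z) i 0 ^+ 2 <= (D z 0%N + S) ^+ 2.
    rewrite (le_trans (sqr_coord_le_dot _ _)) // -enorm_sqr.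
    have D0 : 0 <= D z k.+1 by exact: enorm_ge0.
    by rewrite lerXn2r ?nnegrE ?(le_trans D0) ?D_bnd.
  by rewrite ler_norml => h; apply/andP; split; nra.
have Tws : T ws 0.
  apply: (Tclosed F _ _ _ _ _ Tw Fws).
  exact: cvg_trans (cvg_app _ Foo) v_cvg.
exists ws => //.
(* As [ws] is a zero, its distance to the iterates converges along [\oo]; the limit can be read off
   along [F], where it is 0. *)
have Dl : D ws @ \oo --> limn (D ws) by exact: D_cvg.
have D2l : D ws k * D ws k @[k --> \oo] --> limn (D ws) * limn (D ws).
  exact: cvgM.
have D2l1 : D ws k.+1 * D ws k.+1 @[k --> \oo] --> limn (D ws) * limn (D ws).
  by apply: cvgM; apply: shift.
have D2F : D ws k.+1 * D ws k.+1 @[k --> F] --> limn (D ws) * limn (D ws).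
  exact: cvg_trans (cvg_app _ Foo) D2l1.
have DF0 : D ws k.+1 * D ws k.+1 @[k --> F] --> (0 : R).
  under eq_fun do rewrite -expr2 /D enorm_sqr.
  have w0 : w k.+1 - ws @[k --> F] --> (0 : 'cV[R]_n).
    have h := cvgB Fws (cvg_cst ws); rewrite subrr in h; exact: h.
  have h := cvg_dot w0 w0; rewrite dot0l in h; exact: h.
have l0 : limn (D ws) * limn (D ws) = 0 by apply: cvg_unique D2F DF0.
have w0 : w k - ws @[k --> \oo] --> (0 : 'cV[R]_n).
  apply: cvg_col0; under eq_fun do rewrite -enorm_sqr expr2.
  by rewrite -l0.
rewrite (_ : w = fun k => (w k - ws) + ws); last first.
  by apply/funext => k; rewrite subrK.
have h := cvgD w0 (cvg_cst ws); rewrite add0r in h; exact: h.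
Unshelve. all: by end_near. Qed.

End InexactProximalPoint.

(** * Regularized saddle points and bounds uniform in the regularization *)

Section SaddlePointExistence.
Context {R : realType}.

Definition separable_sum n m (f : 'cV[R]_n -> \bar R) (phi : 'cV[R]_m -> \bar R)
    (w : 'cV[R]_(n + m)) : \bar R :=
  (f (usubmx w) + phi (dsubmx w))%E.

Lemma ltNyeD (a b : \bar R) : (-oo < a -> -oo < b -> -oo < a + b)%E.
Proof. by move: a b => [a| |] [b| |] //= _ _; rewrite ltNyr. Qed.

Lemma ltNye_adde_def (a b : \bar R) :
  (-oo < a)%E -> (-oo < b)%E -> (a +? b)%E.
Proof. by case: a => [a| |]; case: b => [b| |]. Qed.

Lemma separable_sum_proper n m (f : 'cV[R]_n -> \bar R)
    (phi : 'cV[R]_m -> \bar R) :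
  proper_efun f -> proper_efun phi -> proper_efun (separable_sum f phi).
Proof.
move=> [f0 [u fu]] [p0 [v pv]]; split; first by move=> w; exact: ltNyeD.
exists (col_mx u v).
by rewrite /effdom /= /separable_sum col_mxKu col_mxKd lte_add_pinfty.
Qed.

Lemma separable_sum_convex n m (f : 'cV[R]_n -> \bar R)
    (phi : 'cV[R]_m -> \bar R) :
  proper_efun f -> proper_efun phi -> convex_efun f -> convex_efun phi ->
  convex_efun (separable_sum f phi).
Proof.
move=> [f0 _] [p0 _] fcv pcv x y t t01; rewrite /separable_sum !linearP /=.
have dl w : (f (usubmx w) +? phi (dsubmx w))%E by exact: ltNye_adde_def.
rewrite !muleDr // addeACA; apply: leeD; last by rewrite linearZ; exact: pcv.
by rewrite linearZ; exact: fcv.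
Qed.

Lemma separable_sum_lsc n m (f : 'cV[R]_n -> \bar R) (phi : 'cV[R]_m -> \bar R) :
  proper_efun f -> proper_efun phi ->
  lower_semicontinuous f -> lower_semicontinuous phi ->
  lower_semicontinuous (separable_sum f phi).
Proof.
move=> [f0 _] [p0 _] lf lp.
have idc (w : 'cV[R]_(n + m)) : id v @[v --> w] --> w by exact: cvg_id.
apply: lscD => [w|w||]; rewrite ?f0 ?p0 //.
  by apply: (lsc_comp (k := usubmx)) lf => w; exact: cvg_usubmx (idc w).
by apply: (lsc_comp (k := dsubmx)) lp => w; exact: cvg_dsubmx (idc w).
Qed.

Lemma subgradient_separable n m (f : 'cV[R]_n -> \bar R)
    (phi : 'cV[R]_m -> \bar R) w v :
  proper_efun f -> proper_efun phi -> subgradient (separable_sum f phi) w v ->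
  subgradient f (usubmx w) (usubmx v) /\ subgradient phi (dsubmx w) (dsubmx v).
Proof.
move=> [f0 _] [p0 _] /subgradientP[a gw H].
have [r [r' [fr pr ar]]] : exists r r' : R,
    [/\ f (usubmx w) = r%:E, phi (dsubmx w) = r'%:E & a = r + r'].
  move: (f0 (usubmx w)) (p0 (dsubmx w)) gw; rewrite /separable_sum.
  case: (f _) => [r| |] //; case: (phi _) => [r'| |] // _ _ [<-].
  by exists r, r'.
have E u y : dot v (col_mx u y - w) =
    dot (usubmx v) (u - usubmx w) + dot (dsubmx v) (y - dsubmx w).
  rewrite -[in LHS](vsubmxK w) -[in LHS](vsubmxK v) opp_col_mx add_col_mx.
  exact: dot_col_mx.
split; apply/subgradientP.
  exists r => // u; have := H (col_mx u (dsubmx w)).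
  rewrite E subrr dot0r addr0 /separable_sum col_mxKu col_mxKd pr ar.
  by case: (f u) => [b| |] //=; rewrite ?leey // -EFinD !lee_fin; lra.
exists r' => // u; have := H (col_mx (usubmx w) u).
rewrite E subrr dot0r add0r /separable_sum col_mxKu col_mxKd fr ar.
by case: (phi u) => [b| |] //=; rewrite ?leey // -EFinD !lee_fin; lra.
Qed.

(** Minimize f(x) + phi(y) + eps/2 |x|^2 + 1/(2 eps) |E x - y|^2 jointly in (x, y) and put lam = (E
    x - y) / eps; the two blocks of the optimality condition are the two inclusions. *)
Lemma regularized_saddle_point m n (f : 'cV[R]_n -> \bar R)
    (phi : 'cV[R]_m -> \bar R) (E : 'M[R]_(m, n)) af Cf ap Cp (eps : R) :
  proper_efun f -> lower_semicontinuous f -> convex_efun f ->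
  proper_efun phi -> lower_semicontinuous phi -> convex_efun phi ->
  (forall u, ((dot af u - Cf)%:E <= f u)%E) ->
  (forall u, ((dot ap u - Cp)%:E <= phi u)%E) -> 0 < eps ->
  exists x lam, subgradient f x (- (E^T *m lam) - eps *: x) /\
    subgradient phi (E *m x - eps *: lam) lam.
Proof.
move=> fpr flsc fcv ppr plsc pcv fC pC eps0.
pose sg := Num.sqrt eps; have sg0 : 0 < sg by rewrite sqrtr_gt0.
have sg2 : sg * sg = eps by rewrite -expr2 sqr_sqrtr // ltW.
have sgV : sg^-1 * sg = 1 by rewrite mulVf // gt_eqF.
(* [A] sends (x, y) to (sg x, (E x - y) / sg), so half its squared norm is the regularization; [K]
   is its inverse. *)
pose A : 'M[R]_(n + m, n + m) := block_mx sg%:M 0 (sg^-1 *: E) (- sg^-1)%:M.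
pose K : 'M[R]_(n + m, n + m) := block_mx (sg^-1)%:M 0 (sg^-1 *: E) (- sg)%:M.
have KA : K *m A = 1%:M.
  rewrite mulmx_block -!scalar_mxM sgV !mul0mx !mulmx0 !addr0 add0r.
  rewrite mulrN mulNr opprK mulfV ?gt_eqF // scalar_mx_block; congr block_mx.
  rewrite mul_mx_scalar mul_scalar_mx !scalerA mulNr (mulrC sg) sgV.
  by rewrite scaleNr subrr.
have gC u : ((dot (col_mx af ap) u - (Cf + Cp))%:E <= separable_sum f phi u)%E.
  rewrite -{1}(vsubmxK u) dot_col_mx opprD addrACA EFinD; exact: leeD.
have gpr := separable_sum_proper fpr ppr.
have [w wmin] := quadratic_min_exists 0 gpr
  (separable_sum_lsc fpr ppr flsc plsc) gC KA.
have := subgradient_of_quadratic_min gpr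
  (separable_sum_convex fpr ppr fcv pcv) wmin.
move=> /(subgradient_separable fpr ppr).
set x := usubmx w; set y := dsubmx w; rewrite subr0 => fps.
pose lam := eps^-1 *: (E *m x - y); exists x, lam.
have Aw : A^T *m (A *m w) = col_mx (eps *: x + E^T *m lam) (- lam).
  rewrite -{1}(vsubmxK w) -/x -/y mul_block_col tr_block_mx mul_block_col.
  have ei : sg^-1 * sg^-1 = eps^-1 by rewrite -sg2 invfM.
  rewrite !tr_scalar_mx !mul_scalar_mx mul0mx addr0 trmx0 mul0mx add0r linearZ /=.
  have -> : (sg^-1 *: E)^T = sg^-1 *: E^T by rewrite linearZ.
  rewrite -!scalemxAl scalerA sg2 scaleNr -scalerBr -scalemxAr scalerA ei.
  by rewrite scaleNr scalerA ei -scalemxAr.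
move: fps; rewrite Aw opp_col_mx col_mxKu col_mxKd opprK opprD addrC => -[fs ps].
have yE : E *m x - eps *: lam = y.
  by rewrite /lam scalerA mulfV ?gt_eqF // scale1r opprB addrC subrK.
by rewrite yE.
Qed.

(** Add the subgradient inequalities at the two shifted primal points to the affine minorants with
    the two shifted dual slopes: the unshifted terms coupled by [E] cancel. *)
Lemma regularized_bound m n (f : 'cV[R]_n -> \bar R)
    (phi : 'cV[R]_m -> \bar R) (E : 'M[R]_(m, n)) xb lamb t s d' d :
  proper_efun f -> proper_efun phi ->
  effdom f (xb + d') -> effdom phi (E *m xb + d) ->
  effdom (conjugate f) (- (E^T *m lamb) + t) ->
  effdom (conjugate phi) (lamb + s) ->
  exists C : R, forall eps x lam, 0 <= eps <= 1 ->
    subgradient f x (- (E^T *m lam) - eps *: x) ->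
    subgradient phi (E *m x - eps *: lam) lam ->
    dot t x + dot s (E *m x - eps *: lam) + dot d' (- (E^T *m lam) - eps *: x)
      + dot d lam + eps / 2 * (dot x x + dot lam lam) <= C.
Proof.
move=> fpr ppr fd pd cfd cpd.
have [rf fr] := proper_fin_num fpr fd; have [rp pr] := proper_fin_num ppr pd.
have [Cf fC] := conjugate_minorant fpr cfd.
have [Cp pC] := conjugate_minorant ppr cpd.
(* The last term pays for absorbing the products of [x] with [xb] and of [lam] with [lamb] into half
   of the quadratic term, as [eps <= 1]. *)
exists (rf + rp + Cf + Cp + (dot xb xb + dot lamb lamb) / 2).
move=> eps x lam /andP[e0 e1] /subgradientP[a fx Hf] /subgradientP[b py Hp].
have h1 := fC x; have h2 := pC (E *m x - eps *: lam).
have h3 := Hf (xb + d'); have h4 := Hp (E *m xb + d).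
rewrite fx lee_fin in h1; rewrite py lee_fin in h2.
rewrite fr lee_fin in h3; rewrite pr lee_fin in h4.
have h5 := mulr_ge0 e0 (dot_ge0 (x - xb)).
have h6 := mulr_ge0 e0 (dot_ge0 (lam - lamb)).
have h7 : 0 <= (1 - eps) * (dot xb xb + dot lamb lamb).
  by rewrite mulr_ge0 ?subr_ge0 // addr_ge0 ?dot_ge0.
move: h1 h2 h3 h4 h5 h6 h7.
rewrite !dotlin !dot_mulmxl !trmxK (dotC xb x) (dotC lamb lam).
rewrite !(dotC d') !(dotC d) ?dot_mulmxl ?trmxK; lra.
Qed.

(** Points move freely in directions orthogonal to the domain of the conjugate, and slopes in
    directions orthogonal to the domain of [g]; the base points [a] and [b] cancel in
    differences. *)
Lemma subgradient_shift_frame n (g : 'cV[R]_n -> \bar R) k l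
    (Bd : 'M[R]_(k, n)) (Bc : 'M[R]_(l, n)) a b y s v w :
  proper_efun g -> lower_semicontinuous g -> convex_efun g ->
  (forall u v, effdom g u -> Bd *m v = 0 -> dot (u - a) v = 0) ->
  (forall u v, effdom (conjugate g) u -> Bc *m v = 0 -> dot (u - b) v = 0) ->
  subgradient g y s -> Bc *m v = 0 -> Bd *m w = 0 ->
  subgradient g (y + v) (s + w).
Proof.
move=> gpr glsc gcv Hd Hc gys Bv Bw.
have gyv : subgradient g (y + v) s.
  apply: subgradient_shift_point => // t td.
  have := Hc _ _ td Bv; have := Hc _ _ (effdom_conjugate_subgradient gys) Bv.
  rewrite !dotlin; lra.
apply: subgradient_shift_slope => // u ud.
have yvd : effdom g (y + v).
  by case/subgradientP : gyv => r gr _; rewrite /effdom /= gr ltry.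
have := Hd _ _ ud Bw; have := Hd _ _ yvd Bw.
rewrite (dotC w) !dotlin; lra.
Qed.

End SaddlePointExistence.

(** * Saddle points as limits of regularized ones *)

Section SaddlePointLimit.
Context {R : realType}.

Lemma saddle_point_exists m n (f : 'cV[R]_n -> \bar R)
    (phi : 'cV[R]_m -> \bar R) (E : 'M[R]_(m, n)) xb lamb :
  proper_efun f -> lower_semicontinuous f -> convex_efun f ->
  proper_efun phi -> lower_semicontinuous phi -> convex_efun phi ->
  relative_interior (effdom f) xb ->
  relative_interior (effdom phi) (E *m xb) ->
  relative_interior (effdom (conjugate phi)) lamb ->
  relative_interior (effdom (conjugate f)) (- (E^T *m lamb)) ->
  exists x lam, subgradient f x (- (E^T *m lam)) /\ subgradient phi (E *m x) lam.
Proof.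
move=> fpr flsc fcv ppr plsc pcv rf rp rcp rcf.
have [kQ [Q [Qd Qperp]]] := relative_interior_frame rf.
have [kU [U [Ud Uperp]]] := relative_interior_frame rp.
have [kW [W [Wd Wperp]]] := relative_interior_frame rcp.
have [kV [V [Vd Vperp]]] := relative_interior_frame rcf.
have fxb := rf.1; have pxb := rp.1; have cpl := rcp.1; have cfl := rcf.1.
have [Cf fC] := conjugate_minorant fpr cfl.
have [Cp pC] := conjugate_minorant ppr cpl.
pose eps (k : nat) : R := k.+1%:R^-1.
have eps0 k : 0 < eps k by rewrite invr_gt0.
have eps1 k : 0 <= eps k <= 1.
  by rewrite ltW //= invf_le1 ?ltr0n // ler1n.
have epsl : eps @ \oo --> (0 : R) by exact: cvg_harmonic.
have /choice[X /choice[L XL]] k : exists x lam,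
    subgradient f x (- (E^T *m lam) - eps k *: x) /\
    subgradient phi (E *m x - eps k *: lam) lam.
  exact: regularized_saddle_point (eps0 k).
pose Y k := E *m X k - eps k *: L k.
pose G k := - (E^T *m L k) - eps k *: X k.
pose N k := dot (X k) (X k) + dot (L k) (L k).
have N0 k : 0 <= N k by rewrite addr_ge0 ?dot_ge0.
have bnd t s d' d : effdom f (xb + d') -> effdom phi (E *m xb + d) ->
    effdom (conjugate f) (- (E^T *m lamb) + t) ->
    effdom (conjugate phi) (lamb + s) ->
    exists C : R, forall k, dot t (X k) + dot s (Y k) + dot d' (G k)
      + dot d (L k) + eps k / 2 * N k <= C.
  move=> h1 h2 h3 h4.
  have [C HC] := regularized_bound fpr ppr h1 h2 h3 h4.
  exists C => k; have [XLf XLp] := XL k; exact: HC.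
have epsN k : 0 <= eps k / 2 * N k.
  by rewrite mulr_ge0 // divr_ge0 // ltW.
have [F [FU Foo]] := ultra_nat_exists.
have two_sided (u : nat -> R) : (exists C, forall k, u k <= C) ->
    (exists C, forall k, - u k <= C) ->
    exists M, \forall k \near F, `|u k| <= M.
  move=> [C uC] [D uD]; exists (Num.max C D); near=> k.
  by rewrite ler_norml lerNl le_max uD orbT le_max uC.
have fxb0 : effdom f (xb + 0) by rewrite addr0.
have pxb0 : effdom phi (E *m xb + 0) by rewrite addr0.
have cfl0 : effdom (conjugate f) (- (E^T *m lamb) + 0) by rewrite addr0.
have cpl0 : effdom (conjugate phi) (lamb + 0) by rewrite addr0.
(* Shifting one of the four base points by plus and minus a row of its frame bounds the matching
   coordinate from both sides. The next three limits are obtained likewise. *)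
have [v0 Vv] : exists v : 'cV[R]_kV, (V *m X k) @[k --> F] --> v.
  apply: ultra_cvg_col => i; have [dp dm] := Vd i; apply: two_sided.
    have [C HC] := bnd _ _ _ _ fxb0 pxb0 dp cpl0; exists C => k.
    have := HC k; have := epsN k; rewrite mulmx_coord !dot0l; lra.
  have [C HC] := bnd _ _ _ _ fxb0 pxb0 dm cpl0; exists C => k.
  have := HC k; have := epsN k; rewrite mulmx_coord !dot0l dotNl; lra.
have [w0 Wv] : exists v : 'cV[R]_kW, (W *m Y k) @[k --> F] --> v.
  apply: ultra_cvg_col => i; have [dp dm] := Wd i; apply: two_sided.
    have [C HC] := bnd _ _ _ _ fxb0 pxb0 cfl0 dp; exists C => k.
    have := HC k; have := epsN k; rewrite mulmx_coord !dot0l; lra.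
  have [C HC] := bnd _ _ _ _ fxb0 pxb0 cfl0 dm; exists C => k.
  have := HC k; have := epsN k; rewrite mulmx_coord !dot0l dotNl; lra.
have [q0 Qv] : exists v : 'cV[R]_kQ, (Q *m G k) @[k --> F] --> v.
  apply: ultra_cvg_col => i; have [dp dm] := Qd i; apply: two_sided.
    have [C HC] := bnd _ _ _ _ dp pxb0 cfl0 cpl0; exists C => k.
    have := HC k; have := epsN k; rewrite mulmx_coord !dot0l; lra.
  have [C HC] := bnd _ _ _ _ dm pxb0 cfl0 cpl0; exists C => k.
  have := HC k; have := epsN k; rewrite mulmx_coord !dot0l dotNl; lra.
have [u0 Uv] : exists v : 'cV[R]_kU, (U *m L k) @[k --> F] --> v.
  apply: ultra_cvg_col => i; have [dp dm] := Ud i; apply: two_sided.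
    have [C HC] := bnd _ _ _ _ fxb0 dp cfl0 cpl0; exists C => k.
    have := HC k; have := epsN k; rewrite mulmx_coord !dot0l; lra.
  have [C HC] := bnd _ _ _ _ fxb0 dm cfl0 cpl0; exists C => k.
  have := HC k; have := epsN k; rewrite mulmx_coord !dot0l dotNl; lra.
have [C0 HC0] := bnd _ _ _ _ fxb0 pxb0 cfl0 cpl0.
(* With no shift the bound reads [eps k / 2 * N k <= C0], so the squared norm of [eps k *: Z k] is
   at most [eps k * (2 * C0)]. *)
have vanish p (Z : nat -> 'cV[R]_p) : (forall k, dot (Z k) (Z k) <= N k) ->
    eps k *: Z k @[k --> F] --> (0 : 'cV[R]_p).
  move=> ZN; apply: cvg_col0; apply: (cvg_trans (cvg_app _ Foo)).
  have up : eps k * (2 * C0) @[k --> \oo] --> (0 : R).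
    by rewrite -(mul0r (2 * C0)); apply: cvgM => //; exact: cvg_cst.
  apply: (squeeze_cvgr _ (cvg_cst 0) up); near=> k.
  rewrite dot_ge0 dotZl dotZr ler_pM2l //=.
  have := HC0 k; rewrite !dot0l !add0r.
  have := ler_wpM2l (ltW (eps0 k)) (ZN k); lra.
have epsX : eps k *: X k @[k --> F] --> (0 : 'cV[R]_n).
  by apply: vanish => k; rewrite /N lerDl dot_ge0.
have epsL : eps k *: L k @[k --> F] --> (0 : 'cV[R]_m).
  by apply: vanish => k; rewrite /N lerDr dot_ge0.
(* Replacing [X k], [L k] by [X' k], [L' k] leaves the subgradient inclusions
   intact and makes both sequences convergent along [F]. *)
pose A := col_mx V (W *m E); pose D := col_mx U (Q *m E^T).
pose X' k := pinvmx A *m (A *m X k); pose L' k := pinvmx D *m (D *m L k).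
have pinvK p q (B : 'M[R]_(p, q)) (u : 'cV[R]_q) :
    B *m (pinvmx B *m (B *m u)) = B *m u.
  by rewrite mulmxA mulmxA mulmxKpV.
have AX' k : A *m (X' k - X k) = 0.
  by rewrite mulmxBr pinvK subrr.
have DL' k : D *m (L' k - L k) = 0.
  by rewrite mulmxBr pinvK subrr.
have [VX WX] : (forall k, V *m (X' k - X k) = 0) /\
    (forall k, W *m (E *m (X' k - X k)) = 0).
  split=> k; have := AX' k; rewrite mul_col_mx => /eqP;
    rewrite col_mx_eq0 => /andP[/eqP + /eqP +] //.
  by rewrite mulmxA.
have [UL QL] : (forall k, U *m (L' k - L k) = 0) /\
    (forall k, Q *m (E^T *m (L' k - L k)) = 0).
  split=> k; have := DL' k; rewrite mul_col_mx => /eqP;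
    rewrite col_mx_eq0 => /andP[/eqP + /eqP +] //.
  by rewrite mulmxA.
(* The regularization term keeps the original [X k]: it is [eps k *: X k] that is known to
   vanish. *)
have subf k : subgradient f (X' k) (- (E^T *m L' k) - eps k *: X k).
  have [sf _] := XL k.
  have Q0 : Q *m (- (E^T *m (L' k - L k))) = 0 by rewrite mulmxN QL oppr0.
  have := subgradient_shift_frame fpr flsc fcv Qperp Vperp sf (VX k) Q0.
  rewrite (addrC (X k)) subrK mulmxBr; congr subgradient.
  move: (E^T *m L' k) (E^T *m L k) (eps k *: X k) => a b d.
  by apply/colP => i; rewrite !mxE; ring.
have subp k : subgradient phi (E *m X' k - eps k *: L k) (L' k).
  have [_ sp] := XL k.
  have := subgradient_shift_frame ppr plsc pcv Uperp Wperp sp (WX k) (UL k).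
  by rewrite (addrC (L k)) subrK addrAC -mulmxDr (addrC (X k)) subrK.
have EX k : W *m (E *m X k) = W *m Y k + W *m (eps k *: L k).
  by rewrite -mulmxDr /Y subrK.
(* [X' k] depends on [X k] only through [A *m X k], whose two blocks converge even if [X k] does
   not. *)
have [x Xx] : exists x : 'cV[R]_n, X' @ F --> x.
  exists (pinvmx A *m col_mx v0 (w0 + W *m 0)); apply: cvg_mulmx.
  rewrite (_ : (fun k => A *m X k) =
    fun k => col_mx (V *m X k) (W *m Y k + W *m (eps k *: L k))); last first.
    by apply/funext => k; rewrite mul_col_mx -mulmxA EX.
  by apply: cvg_col_mx => //; apply: cvgD => //; exact: cvg_mulmx.
have EL k : Q *m (E^T *m L k) = - (Q *m G k) - Q *m (eps k *: X k).
  by rewrite -mulmxN -mulmxBr /G opprB addrAC subrr sub0r opprK.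
have [l Ll] : exists l : 'cV[R]_m, L' @ F --> l.
  exists (pinvmx D *m col_mx u0 (- q0 - Q *m 0)); apply: cvg_mulmx.
  rewrite (_ : (fun k => D *m L k) =
    fun k => col_mx (U *m L k) (- (Q *m G k) - Q *m (eps k *: X k))); last first.
    by apply/funext => k; rewrite mul_col_mx -mulmxA EL.
  apply: cvg_col_mx => //; apply: cvgB; first exact: cvgN.
  exact: cvg_mulmx.
exists x, l; split.
  apply: (subgradient_closed (F := F) fpr flsc _ Xx).
    by near=> k; exact: subf.
  rewrite -[X in _ --> X]subr0; apply: cvgB => //; apply: cvgN.
  exact: cvg_mulmx.
apply: (subgradient_closed (F := F) ppr plsc _ _ Ll).
  by near=> k; exact: subp.
by rewrite -[X in _ --> X]subr0; apply: cvgB => //; exact: cvg_mulmx.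
Unshelve. all: by end_near. Qed.

End SaddlePointLimit.

(** * Parameter sequences, optimality of saddle points and convergence of the method *)

Section Optimality.
Context {R : realType}.

(** The lower limit is the supremum of the tail infima, so some tail infimum is positive; it is
    finite because the terms are real. *)
Lemma limn_einf_gt0_bounded_below (c : nat -> R) :
  (0 < limn_einf (fun k => (c k)%:E))%E ->
  exists2 d : R, 0 < d & \forall k \near \oo, d <= c k.
Proof.
rewrite limn_einf_lim.
rewrite (cvg_lim _ (ereal_nondecreasing_cvgn (nondecreasing_einfs _))) //.
move=> /ereal_sup_gt[_ [N _ <-]] N0.
have cN k : (N <= k)%N -> (einfs (fun k => (c k)%:E) N <= (c k)%:E)%E.
  by move=> Nk; apply: ereal_inf_lbound; exists k.
move: N0 cN; case: (einfs _ N) => [d| |] // d0 cN; last first.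
  by have := cN N (leqnn N).
by exists d => //; exists N => // k /= Nk; have := cN k Nk.
Qed.

Lemma nneseries_lty_bounded (eps : nat -> R) : (forall k, 0 <= eps k) ->
  (\sum_(0 <= k <oo) (eps k)%:E < +oo)%E ->
  exists S, forall k, \sum_(0 <= j < k) eps j <= S.
Proof.
move=> eps0; set s := (\sum_(0 <= k <oo) _)%E => sfin.
have le k : ((\sum_(0 <= j < k) eps j)%:E <= s)%E.
  by rewrite -sumEFin; apply: nneseries_lim_ge => j _ _; rewrite lee_fin.
move: sfin le; case: s => [S| |] // _ le; first by exists S => k; have := le k.
by have := le 0%N.
Qed.

(** The primal part adds the two subgradient inequalities. For the dual part, testing both
    conjugates at [x] and [E *m x] bounds every dual value by f(x) + phi(E x), which is attained at
    [lam] by the Fenchel-Young equality. *)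
Lemma saddle_point_optimal m n (f : 'cV[R]_n -> R)
    (phi : 'cV[R]_m -> \bar R) (E : 'M[R]_(m, n)) x lam :
  subgradient (EFin \o f) x (- (E^T *m lam)) -> subgradient phi (E *m x) lam ->
  minimizers (primal_objective f phi E) x /\
  maximizers (dual_objective f phi E) lam.
Proof.
move=> fs ps; have cf := conjugate_subgradient fs.
have cp := conjugate_subgradient ps.
have /subgradientP[a pa Hp] := ps; have [_ Hf] := fs.
split=> v.
  have := Hf v; have := Hp (E *m v); rewrite /primal_objective pa /= lee_fin.
  rewrite -mulmxBr dotNl dot_mulmxl trmxK.
  by case: (phi _) => [b| |] //=; rewrite ?leey // -EFinD !lee_fin; lra.
rewrite /dual_objective cf cp pa /=.
have ubf : ((dot (- (E^T *m v)) x)%:E - (f x)%:E <=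
    conjugate (EFin \o f) (- (E^T *m v)))%E by apply: ereal_sup_ubound; exists x.
have ubp : ((dot v (E *m x))%:E - a%:E <= conjugate phi v)%E.
  by apply: ereal_sup_ubound; exists (E *m x); rewrite ?pa.
move: ubf ubp; case: (conjugate (EFin \o f) _) => [r| |] //;
  case: (conjugate phi _) => [s| |] //; rewrite ?leNye //.
rewrite -!EFinB -?EFinD !lee_fin !dotNl !dot_mulmxl !trmxK; lra.
Qed.

End Optimality.

Theorem theorem3p1 (R : realType) (m n : nat)
    (f : 'cV[R]_n -> R) (phi : 'cV[R]_m -> \bar R) (E : 'M[R]_(m, n))
    (f_C2 : twice_continuously_differentiable f)
    (f_convex : convex_function [set: convex_lmodType 'cV[R]_n] f)
    (phi_proper : proper_efun phi)
    (phi_closed : lower_semicontinuous phi)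
    (phi_convex : convex_efun phi)
    (A1 : exists x : 'cV[R]_n,
        relative_interior (effdom (EFin \o f)) x /\
        relative_interior (effdom phi) (E *m x))
    (A2 : exists lam : 'cV[R]_m,
        relative_interior (effdom (conjugate phi)) lam /\
        relative_interior (effdom (conjugate (EFin \o f))) (- (E^T *m lam)))
    (r : R) (r_ge0 : 0 <= r)
    (c : nat -> R) (c_gt0 : forall k, 0 < c k)
    (c_liminf : (0 < limn_einf (fun k => (c k)%:E))%E)
    (eps : nat -> R) (eps_gt0 : forall k, 0 < eps k)
    (eps_summable : (\sum_(0 <= k <oo) (eps k)%:E < +oo)%E)
    (x : nat -> 'cV[R]_n) (lam : nat -> 'cV[R]_m)
    (lam_update : forall k,
        lam k.+1 = lam k + c k *:
          (E *m x k.+1 - prox phi (c k) (E *m x k.+1 + (c k)^-1 *: lam k)))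
    (x_update : forall k,
        enorm (gradient (fun u => aug_lagrangian f phi E (c k) u (lam k))
                 (x k.+1) + (c k)^-1 *: (x k.+1 - x k))
        <= eps k / c k *
           Num.min 1
             (enorm (col_mx (x k.+1) (lam k.+1) - col_mx (x k) (lam k)) `^ r)) :
  (exists2 xs : 'cV[R]_n,
      x k @[k --> \oo] --> xs & minimizers (primal_objective f phi E) xs) /\
  (exists2 lams : 'cV[R]_m,
      lam k @[k --> \oo] --> lams &
      maximizers (dual_objective f phi E) lams).
Proof.
have [f_diff _ _] := f_C2.
have [xb [rf rp]] := A1; have [lamb [rcp rcf]] := A2.
have fpr : proper_efun (EFin \o f).
  by split=> [u|]; [exact: ltNyr|exists 0; exact: ltry].
have flsc : lower_semicontinuous (EFin \o f).
  by apply: lsc_EFin => u; exact: differentiable_continuous (f_diff u).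
have fcv := convex_efun_EFin f_convex.
have [x0 [lam0 [f0 p0]]] := saddle_point_exists fpr flsc fcv
  phi_proper phi_closed phi_convex rf rp rcp rcf.
have [Cp pC] := conjugate_minorant phi_proper rcp.1.
have [d d0 dc] := limn_einf_gt0_bounded_below c_liminf.
have eps0 k : 0 <= eps k by exact: ltW.
have [S epsS] := nneseries_lty_bounded eps0 eps_summable.
(* The inverse of the subdifferential of [phi] is avoided by exchanging point and slope in the
   second inclusion. *)
pose T (w v : 'cV[R]_(n + m)) :=
  subgradient (EFin \o f) (usubmx w) (usubmx v - E^T *m dsubmx w) /\
  subgradient phi (E *m usubmx w + dsubmx v) (dsubmx w).
pose g k := gradient (fun u => aug_lagrangian f phi E (c k) u (lam k)) (x k.+1).
pose w k := col_mx (x k) (lam k).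
(* The error is [c k] times the gradient residual in the primal block, and zero in the dual block
   since the multiplier update is exact. *)
pose e k := col_mx (c k *: (g k + (c k)^-1 *: (x k.+1 - x k))) (0 : 'cV[R]_m).
have [|||||ws wws [fs ps]] := @inexact_proximal_point R _ T c eps w e
    (col_mx x0 lam0) d S _ _ _ c_gt0 d0 dc eps0 epsS.
- move=> w1 v1 w2 v2 [f1 p1] [f2 p2].
  have := subgradient_monotone f1 f2; have := subgradient_monotone p1 p2.
  rewrite -(vsubmxK v1) -(vsubmxK v2) -(vsubmxK w1) -(vsubmxK w2).
  rewrite !opp_col_mx !add_col_mx dot_col_mx !(col_mxKu, col_mxKd).
  move: (usubmx w1) (usubmx w2) (usubmx v1) (usubmx v2) => a1 a2 b1 b2.
  move: (dsubmx w1) (dsubmx w2) (dsubmx v1) (dsubmx v2) => l1 l2 u1 u2.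
  rewrite !dotlin !dot_mulmxl !trmxK.
  rewrite !(dotC u1) !(dotC u2); lra.
- move=> F w1 v1 w2 v2 FF T12 w12 v12; split.
    apply: (subgradient_closed (F := F) fpr flsc _ (cvg_usubmx w12)).
      by near=> k; exact: (T12 k).1.
    apply: cvgB; first exact: cvg_usubmx.
    by apply: cvg_mulmx; exact: cvg_dsubmx.
  apply: (subgradient_closed (F := F) phi_proper phi_closed _ _ (cvg_dsubmx w12)).
    by near=> k; exact: (T12 k).2.
  apply: cvgD; last exact: cvg_dsubmx.
  by apply: cvg_mulmx; exact: cvg_usubmx.
- by rewrite /T col_mxKu col_mxKd !linear0 sub0r addr0.
- move=> k; rewrite /enorm /e dot_col_mx dot0l addr0 -/(enorm _) enormZ.
  rewrite gtr0_norm // mulrC -ler_pdivlMr // (le_trans (x_update k)) //.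
  by rewrite ler_piMr ?divr_ge0 ?ge_min ?lexx // ltW.
- move=> k.
  have ck0 : c k != 0 by rewrite gt_eqF.
  pose z := E *m x k.+1 + (c k)^-1 *: lam k.
  (* The new multiplier is the gradient of the envelope at [z], hence a subgradient of [phi] at the
     proximal point, and it is the vector to which [E^T] is applied in [g k]. *)
  have lamE : lam k.+1 = c k *: (z - prox phi (c k) z).
    rewrite lam_update -/z addrC /z addrAC (scalerDr _ (_ - _)) scalerA mulfV //.
    by rewrite scale1r.
  have gE : g k = gradient f (x k.+1) + E^T *m lam k.+1.
    rewrite lamE; exact: (gradient_aug_lagrangian E (lam k)).
  have -> : (c k)^-1 *: (w k + e k - w k.+1) =
      col_mx (g k) ((c k)^-1 *: (lam k - lam k.+1)).
    rewrite /w /e opp_col_mx !add_col_mx scale_col_mx addr0; congr col_mx.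
    rewrite addrAC scalerDr scalerA mulVf // scale1r addrCA -scalerDr.
    by rewrite addrA subrK subrr scaler0 addr0.
  rewrite /T !col_mxKu !col_mxKd gE addrK; split.
    exact: gradient_subgradient.
  have -> : E *m x k.+1 + (c k)^-1 *: (lam k - lam k.+1) = prox phi (c k) z.
    rewrite scalerBr addrA -/z {1}lamE scalerA mulVf // scale1r.
    by rewrite opprB addrC subrK.
  by rewrite lamE; exact: subgradient_prox pC (c_gt0 k).
rewrite linear0 sub0r in fs; rewrite linear0 addr0 in ps.
have [xmin lmax] := saddle_point_optimal fs ps.
split; [exists (usubmx ws) => //|exists (dsubmx ws) => //].
  rewrite (_ : x = fun k => usubmx (w k)); first exact: cvg_usubmx.
  by apply/funext => k; rewrite col_mxKu.
rewrite (_ : lam = fun k => dsubmx (w k)); first exact: cvg_dsubmx.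
by apply/funext => k; rewrite col_mxKd.
Unshelve. all: by end_near. Qed.
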